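(* Let $R$ be a skew-invertible Hecke $R$-matrix of symmetry rank $p$, $\mathcal{L}_q$ the corresponding modified reflection equation algebra with generators $l_i^{\,j}$, and $V$ its fundamental module of $B$ type with basis $e_1,\dots,e_n$. For a positive integer $k$ consider the $\mathcal{L}_q$-module structure $\rho_k$ on $V^{\otimes k}$ and the decomposition $$V^{\otimes k}=\bigoplus_{\nu\vdash k}\bigoplus_{a=1}^{\dim[\nu]}V_{\nu(a)},\qquad V_{\nu(a)}=Y_{\nu(a)}(R)\triangleright V^{\otimes k}$$ (all defined in the context). Then each component $V_{\nu(a)}$ is an $\mathcal{L}_q$-module in which the generators are represented by linear operators $\pi_{\nu(a)}(l_i^{\,j})\in\mathrm{End}(V_{\nu(a)})\hookrightarrow \mathrm{End}(V^{\otimes k})$ whose matrices in the basis $e_{i_1}\otimes\dots\otimes e_{i_k}$ are $$\pi^t_{\nu(a)}(l_i^{\,j})=Y_{\nu(a)}(R)\,\rho_k^t(l_i^{\,j})\,Y_{\nu(a)}(R).$$ The modules $V_{\nu(a)}$ and $V_{\nu(b)}$ parametrized by different standard tableaux of the same partition $\nu\vdash k$ are equivalent.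
   Context: **Matrices.** Fix $n\ge 1$ and a nonzero $q\in\mathbb{C}$ with $q^k\ne 1$ for all integers $k\geq 1$. Put $\lambda=q-q^{-1}$, $k_q=(q^k-q^{-k})/(q-q^{-1})$. Lower indices of a matrix enumerate rows, upper indices columns. Subscripts of a matrix indicate the tensor factors in which it acts; $I$ is the unit matrix, $P$ the permutation (flip) matrix, $Tr_{(i)}$ the trace in the $i$-th factor. $R_i:=R_{i\,i+1}$. Chains: $R^{\pm1}_{(i\to j)}=R_i^{\pm1}R_{i+1}^{\pm1}\cdots R_j^{\pm1}$ if $i<j$, $R_i^{\pm1}R_{i-1}^{\pm1}\cdots R_j^{\pm1}$ if $i>j$, and $R_i^{\pm1}$ if $i=j$. **$R$-matrix.** $R$ is a complex $n^2\times n^2$ matrix with: (Yang–Baxter) $R_{12}R_{23}R_{12}=R_{23}R_{12}R_{23}$; (Hecke) $(R-qI)(R+q^{-1}I)=0$; (skew-invertibility) there is $\Psi$ with $Tr_{(2)}R_{12}\Psi_{23}=P_{13}=Tr_{(2)}\Psi_{12}R_{23}$; (symmetry rank $p\in\mathbb{N}$) $A^{(p+1)}=0$ and $\mathrm{rank}\,A^{(p)}=1$, where $A^{(1)}=I$, $A^{(k)}_{12\dots k}=\frac{1}{k_q}A^{(k-1)}_{2\dots k}\bigl(q^{k-1}I-(k-1)_qR_{12}\bigr)A^{(k-1)}_{2\dots k}$. Put $B_1=Tr_{(2)}\Psi_{21}$. **Algebra and fundamental module.** $\mathcal{L}_q$ is the unital associative $\mathbb{C}$-algebra generated by $l_i^{\,j}$,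 $1\le i,j\le n$, with relations $R_{12}L_1R_{12}L_1-L_1R_{12}L_1R_{12}=R_{12}L_1-L_1R_{12}$, $L=\|l_i^{\,j}\|$, $L_1=L\otimes I$. $V$ is an $n$-dimensional space with basis $e_i$ and action $\pi(l_i^{\,j})e_k=e_iB_k^{\,j}$. **Conventions for matrices of operators.** A numerical matrix $X$ acts on $V^{\otimes k}$ by $X\triangleright e_I=\sum_JX_I^{\,J}e_J$, where $e_I=e_{i_1}\otimes\dots\otimes e_{i_k}$. For an operator $\tau(x)$ on $V^{\otimes k}$, $\tau^t(x)$ denotes the transposed matrix, i.e. $\tau(x)e_I=\sum_J(\tau^t(x))_I^{\,J}e_J$. **Module $V^{\otimes k}$.** It is an $\mathcal{L}_q$-module via $\rho_k^t(l_i^{\,j})=\pi^t(l_i^{\,j})\otimes I^{\otimes(k-1)}+\sum_{s=1}^{k-1}R^{-1}_{(s\to1)}\bigl[\pi^t(l_i^{\,j})\otimes I^{\otimes(k-1)}\bigr]R^{-1}_{(1\to s)}$. **Young idempotents.** $H_k(q)$ is the Hecke algebra with generators $\sigma_1,\dots,\sigma_{k-1}$ and relations $\sigma_i\sigma_{i+1}\sigma_i=\sigma_{i+1}\sigma_i\sigma_{i+1}$, $\sigma_i\sigma_j=\sigma_j\sigma_i$ for $|i-j|\ge2$, $(\sigma_i-q)(\sigma_i+q^{-1})=0$; its local representation on $V^{\otimes k}$ is $\sigma_i\mapsto R_i$. Its Jucys–Murphy elements are $\mathcal{J}_1=1$, $\mathcal{J}_i=\sigma_{i-1}\cdots\sigma_1\sigma_1\cdots\sigma_{i-1}$.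 For $\nu\vdash k$, $\nu(1),\dots,\nu(\dim[\nu])$ are the standard Young tableaux of shape $\nu$. $\mathcal{Y}_{\nu(a)}(\sigma)$ are the $q$-Young idempotents: the complete family of mutually orthogonal primitive idempotents of $H_k(q)$, summing to $1$, characterized by $\mathcal{J}_i\mathcal{Y}_{\nu(a)}=\mathcal{Y}_{\nu(a)}\mathcal{J}_i=q^{2(c_i-r_i)}\mathcal{Y}_{\nu(a)}$, $1\le i\le k$, where $c_i,r_i$ are the column and row numbers of the box containing $i$ in $\nu(a)$. $Y_{\nu(a)}(R)$ is the image of $\mathcal{Y}_{\nu(a)}(\sigma)$ under $\sigma_i\mapsto R_i$. *)

(* Defs.v *)
From HB Require Import structures.
From mathcomp Require Import all_boot all_order all_algebra generic_quotient.
From mathcomp Require Import ring_quotient boolp reals complex.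
From mathcomp Require Import finmap monalg.

Set Implicit Arguments.
Unset Strict Implicit.
Unset Printing Implicit Defensive.

Import GRing.Theory Num.Theory.
Local Open Scope ring_scope.
Local Open Scope quotient_scope.

(** * Algebras given by generators and relations *)

(* The free algebra F<X>: the monoid algebra of the free monoid on X. *)
Definition freealg (F : fieldType) (X : choiceType) : Type :=
  @malg (fmonom X) F.

HB.instance Definition _ (F : fieldType) (X : choiceType) :=
  GRing.Lalgebra.copy (freealg F X) (@malg (fmonom X) F).

Definition fgen (F : fieldType) (X : choiceType) (x : X) : freealg F X :=
  mkmalgU (fmu x) 1.

(* The value of a noncommutative polynomial at a family of square matrices.  *)
Definition feval (F : fieldType) (X : choiceType) (N : nat) (f : X -> 'M[F]_N)
    (g : freealg F X) : 'M[F]_N :=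
  \sum_(w <- msupp g) mcoeff w g *: \prod_(x <- val w) f x.

Section IdealQuotient.
Variables (F : fieldType) (A : lalgType F) (S : A -> Prop).

Definition two_sided_ideal (I : A -> Prop) : Prop :=
  [/\ I 0, (forall x y, I x -> I y -> I (x + y)) &
      (forall a x, I x -> I (a * x) /\ I (x * a))].

Definition ideal_gen (x : A) : Prop :=
  forall I, two_sided_ideal I -> (forall s, S s -> I s) -> I x.

Definition ideal_pred : {pred A} := fun x => `[< ideal_gen x >].

Lemma ideal_genP : two_sided_ideal ideal_gen.
Proof.
split=> [I [] //|x y Ix Iy I HI SI|a x Ix].
  by case: (HI) => _ D _; apply: D; [apply: Ix|apply: Iy].
by split=> I HI SI; case: (HI) => _ _ /(_ a x (Ix I HI SI)) [].
Qed.

Lemma ideal_pred_zmod : zmod_closed ideal_pred.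
Proof.
have [I0 ID IM] := ideal_genP.
split=> [|x y]; first exact/asboolP.
move=> /asboolP Ix /asboolP Iy; apply/asboolP.
apply: (ID x (- y) Ix); rewrite -mulN1r.
by case: (IM (-1) y Iy).
Qed.

HB.instance Definition _ := GRing.isZmodClosed.Build A ideal_pred ideal_pred_zmod.

Lemma ideal_predMl a x : x \in ideal_pred -> a * x \in ideal_pred.
Proof.
by have [_ _ IM] := ideal_genP; move=> /asboolP /(IM a) [] *; apply/asboolP.
Qed.

Lemma ideal_predMr a x : x \in ideal_pred -> x * a \in ideal_pred.
Proof.
by have [_ _ IM] := ideal_genP; move=> /asboolP /(IM a) [] *; apply/asboolP.
Qed.

Definition ideal : zmodClosed A := ideal_pred.

(* The quotient of A by the two-sided ideal generated by S; the library only
   puts a ring structure on quotients of commutative rings.                   *)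
Definition qalg : Type := {ideal_quot ideal}.

HB.instance Definition _ := GRing.Zmodule.on qalg.

Definition qpi (x : A) : qalg := \pi_{ideal_quot ideal} x.
Definition qrepr (x : qalg) : A := repr (x : {ideal_quot ideal}).

Lemma qreprK : cancel qrepr qpi.
Proof. exact: reprK. Qed.

Definition qone : qalg := qpi 1.
Definition qmul (x y : qalg) : qalg := qpi (qrepr x * qrepr y).
Definition qscale (c : F) (x : qalg) : qalg := qpi (c *: qrepr x).

Lemma qpiP (x y : A) : reflect (qpi x = qpi y) (x - y \in ideal_pred).
Proof. by rewrite (Quotient.idealrBE ideal); apply: (iffP eqP). Qed.

Lemma qrepr_pi (x : A) : qrepr (qpi x) - x \in ideal_pred.
Proof. by apply/qpiP; rewrite qreprK. Qed.

Lemma qpiD (x y : A) : qpi (x + y) = qpi x + qpi y.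
Proof. exact: (raddfD (\pi_{ideal_quot ideal})). Qed.

Lemma qpiM (x y : A) : qpi (x * y) = qmul (qpi x) (qpi y).
Proof.
apply/esym/qpiP.
have -> : qrepr (qpi x) * qrepr (qpi y) - x * y =
    qrepr (qpi x) * (qrepr (qpi y) - y) + (qrepr (qpi x) - x) * y.
  by rewrite mulrBr mulrBl addrA subrK.
by rewrite rpredD //; [apply: ideal_predMl|apply: ideal_predMr]; apply: qrepr_pi.
Qed.

Lemma qpiZ c (x : A) : qpi (c *: x) = qscale c (qpi x).
Proof.
apply/esym/qpiP; rewrite -scalerBr -mulr_algl.
exact/ideal_predMl/qrepr_pi.
Qed.

Lemma qmulA : associative qmul.
Proof.
by move=> x y z; rewrite -[x]qreprK -[y]qreprK -[z]qreprK -!qpiM mulrA.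
Qed.
Lemma qmul1 : left_id qone qmul.
Proof. by move=> x; rewrite -[x]qreprK -qpiM mul1r. Qed.
Lemma qmulr1 : right_id qone qmul.
Proof. by move=> x; rewrite -[x]qreprK -qpiM mulr1. Qed.
Lemma qmulDl : left_distributive qmul +%R.
Proof.
move=> x y z; rewrite -[x]qreprK -[y]qreprK -[z]qreprK.
by rewrite -qpiD -!qpiM -qpiD mulrDl.
Qed.
Lemma qmulDr : right_distributive qmul +%R.
Proof.
move=> x y z; rewrite -[x]qreprK -[y]qreprK -[z]qreprK.
by rewrite -qpiD -!qpiM -qpiD mulrDr.
Qed.

HB.instance Definition _ := GRing.Zmodule_isPzRing.Build qalg
  qmulA qmul1 qmulr1 qmulDl qmulDr.

Lemma qscaleA a b x : qscale a (qscale b x) = qscale (a * b) x.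
Proof. by rewrite -[x]qreprK -!qpiZ scalerA. Qed.
Lemma qscale1 : left_id 1 qscale.
Proof. by move=> x; rewrite -[x]qreprK -qpiZ scale1r. Qed.
Lemma qscaleDr : right_distributive qscale +%R.
Proof.
move=> a x y; rewrite -[x]qreprK -[y]qreprK.
by rewrite -qpiD -!qpiZ -qpiD scalerDr.
Qed.
Lemma qscaleDl x : {morph qscale^~ x : a b / a + b}.
Proof. by move=> a b; rewrite -[x]qreprK -!qpiZ -qpiD scalerDl. Qed.

HB.instance Definition _ := GRing.Zmodule_isLmodule.Build F qalg
  qscaleA qscale1 qscaleDr qscaleDl.

Lemma qalg_scalerAl c (x y : qalg) : c *: (x * y) = (c *: x) * y.
Proof.
rewrite -[x]qreprK -[y]qreprK; change (qscale c (qmul (qpi (qrepr x)) (qpi (qrepr y))) =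
  qmul (qscale c (qpi (qrepr x))) (qpi (qrepr y))).
by rewrite -qpiM -!qpiZ -qpiM scalerAl.
Qed.

End IdealQuotient.

(** * Matrices on tensor powers *)

(* The index e_I = e_{i_1} (x) ... (x) e_{i_k} of a basis vector.             *)
Definition widx (n k : nat) : finType := {ffun 'I_k -> 'I_n}.

(* n^k x n^k matrices; lower indices I are rows, upper indices J columns, and
   tensor factors are numbered from 0.                                        *)
Notation tmx T n k := 'M[T]_#|widx n k|.

Section TensorMatrices.
Variables (T : nmodType) (n : nat).

Definition tmx_of k (E : widx n k -> widx n k -> T) : tmx T n k :=
  \matrix_(a, b) E (enum_val a) (enum_val b).

Definition ent k (X : tmx T n k) (I J : widx n k) : T :=
  X (enum_rank I) (enum_rank J).

(* X acting in the factors f 0, ..., f (m-1) (f injective) of V^{(x) k}, and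
   as the identity in the others.                                             *)
Definition emb m k (f : 'I_m -> 'I_k) (X : tmx T n m) : tmx T n k :=
  tmx_of (fun I J =>
    if [forall c, (c \notin codom f) ==> (I c == J c)]
    then ent X [ffun a => I (f a)] [ffun a => J (f a)] else 0).

Definition at2 k (a b : 'I_k) (X : tmx T n 2) : tmx T n k :=
  emb (tnth [tuple a; b]) X.

Definition at1 k (a : 'I_k) (X : 'M[T]_n) : tmx T n k :=
  emb (fun _ : 'I_1 => a) (tmx_of (fun I J => X (I ord0) (J ord0))).

Definition widx_insert k (a : 'I_k.+1) (x : 'I_n) (I : widx n k) : widx n k.+1 :=
  [ffun c => if unlift a c is Some d then I d else x].

(* Trace in the factor a; the remaining factors keep their order.             *)
Definition ptrace k (a : 'I_k.+1) (X : tmx T n k.+1) : tmx T n k :=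
  tmx_of (fun I J => \sum_(x < n) ent X (widx_insert a x I) (widx_insert a x J)).

End TensorMatrices.

Definition flip_mx (T : pzSemiRingType) (n : nat) : tmx T n 2 :=
  tmx_of (fun I J => ((I ord0 == J ord_max) && (I ord_max == J ord0))%:R).

(** * R-matrices *)

Definition qnum (F : fieldType) (q : F) (k : nat) : F :=
  (q ^+ k - q ^- k) / (q - q^-1).

Section RMatrix.
Variables (F : fieldType) (n : nat) (q : F) (R : tmx F n 2).

(* R_{i+1} = R_{i+1,i+2} on V^{(x) (k+1)}, for i < k.                         *)
Definition Rat (k i : nat) : tmx F n k.+1 := at2 (inord i) (inord i.+1) R.

Definition yang_baxter : Prop :=
  Rat 2 0 *m Rat 2 1 *m Rat 2 0 = Rat 2 1 *m Rat 2 0 *m Rat 2 1.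

Definition hecke_condition : Prop :=
  (R - q%:M) *m (R + (q^-1)%:M) = 0.

Definition skew_inverse (Psi : tmx F n 2) : Prop :=
  ptrace (inord 1) (Rat 2 0 *m at2 (inord 1) (inord 2) Psi) = flip_mx F n /\
  ptrace (inord 1) (at2 (inord 0) (inord 1) Psi *m Rat 2 1) = flip_mx F n.

(* asym k is the antisymmetrizer A^{(k+1)}.                                   *)
Fixpoint asym (k : nat) : tmx F n k.+1 :=
  if k is k'.+1 then
    let A2 := emb (lift ord0) (asym k') in
    (qnum q k'.+2)^-1 *:
      (A2 *m ((q ^+ k'.+1)%:M - qnum q k'.+1 *: Rat k'.+1 0) *m A2)
  else 1%:M.

Definition symmetry_rank (p : nat) : Prop :=
  if p is p'.+1 then asym p = 0 /\ \rank (asym p') = 1%N else False.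

(* B_1 = Tr_(2) Psi_21.                                                       *)
Definition Bmx (Psi : tmx F n 2) : 'M[F]_n :=
  \matrix_(i, j) ent (ptrace ord_max (at2 ord_max ord0 Psi) : tmx F n 1)
                     [ffun=> i] [ffun=> j].

(** * The modified reflection equation algebra *)

Definition REfree : Type := freealg F ('I_n * 'I_n)%type.
HB.instance Definition _ := GRing.Lalgebra.on REfree.

Definition RE_L1 : tmx REfree n 2 :=
  at1 ord0 (\matrix_(i, j) (fgen F (i, j) : REfree)).

Definition RE_R12 : tmx REfree n 2 := map_mx (fun c : F => c%:A : REfree) R.

Definition RE_relation : tmx REfree n 2 :=
  (RE_R12 *m RE_L1 *m RE_R12 *m RE_L1 - RE_L1 *m RE_R12 *m RE_L1 *m RE_R12)
  - (RE_R12 *m RE_L1 - RE_L1 *m RE_R12).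

Definition Lq : Type := qalg (fun x : REfree => exists I J, x = RE_relation I J).
HB.instance Definition _ := GRing.PzRing.on Lq.
HB.instance Definition _ := GRing.Lmodule.on Lq.

Definition lgen (i j : 'I_n) : Lq := qpi _ (fgen F (i, j) : REfree).

Definition Lq_module (W : vectType F) (pi : Lq -> 'End(W)) : Prop :=
  [/\ (forall c x y, pi (c *: x + y) = c *: pi x + pi y),
      pi 1 = \1%VF &
      (forall x y, pi (x * y) = (pi x \o pi y)%VF)].

Definition Lq_equiv (W W' : vectType F) (pi : Lq -> 'End(W)) (pi' : Lq -> 'End(W')) :
    Prop :=
  exists2 f : 'Hom(W, W'), bijective f & forall x, (f \o pi x = pi' x \o f)%VF.

(** * The module structure on V^{(x) (k+1)} *)

(* The transposed matrix of pi(l_i^j) : e_m |-> B_m^j e_i. *)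
Definition pit (Psi : tmx F n 2) (i j : 'I_n) : 'M[F]_n :=
  \matrix_(m, s) (Bmx Psi m j * (s == i)%:R).

(* R^{-1}_{(s -> 1)} and R^{-1}_{(1 -> s)}; both are the identity for s = 0. *)
Definition chain_down (k s : nat) : tmx F n k.+1 :=
  \prod_(i <- rev (iota 0 s)) invmx (Rat k i).
Definition chain_up (k s : nat) : tmx F n k.+1 :=
  \prod_(i <- iota 0 s) invmx (Rat k i).

Definition rhot (Psi : tmx F n 2) (k : nat) (i j : 'I_n) : tmx F n k.+1 :=
  at1 ord0 (pit Psi i j) +
  \sum_(1 <= s < k.+1)
    chain_down k s *m at1 ord0 (pit Psi i j) *m chain_up k s.

End RMatrix.

(* V^{(x) k}, in coordinates: e_I is the row vector delta_mx 0 (enum_rank I). *)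
Notation tvec F n k := 'rV[F]_#|widx n k|.

(* X |> e_I = \sum_J X_I^J e_J, so that X |> v is the row vector v *m X.      *)
Definition mxact (F : fieldType) (N : nat) (X : 'M[F]_N) : 'End('rV[F]_N) :=
  linfun (mulmxr X).

(** * Hecke algebras and q-Young idempotents *)

Section HeckeAlgebra.
Variables (F : fieldType) (q : F) (k : nat).

Definition Hfree : Type := freealg F 'I_k.
HB.instance Definition _ := GRing.Lalgebra.on Hfree.

Variant hecke_rel : Hfree -> Prop :=
| Hecke_braid (i j : 'I_k) of j = i.+1 :> nat :
    hecke_rel (fgen F i * fgen F j * fgen F i - fgen F j * fgen F i * fgen F j : Hfree)
| Hecke_comm (i j : 'I_k) of (i.+1 < j)%N || (j.+1 < i)%N :
    hecke_rel (fgen F i * fgen F j - fgen F j * fgen F i : Hfree)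
| Hecke_quad (i : 'I_k) :
    hecke_rel ((fgen F i - q%:A) * (fgen F i + q^-1%:A) : Hfree).

(* H_{k+1}(q), with generators sigma_{i+1}, i : 'I_k.                         *)
Definition hecke : Type := qalg hecke_rel.
HB.instance Definition _ := GRing.PzRing.on hecke.
HB.instance Definition _ := GRing.Lmodule.on hecke.

Definition sigma (i : 'I_k) : hecke := qpi _ (fgen F i : Hfree).

(* The Jucys-Murphy element J_{i+1}, for 0 <= i <= k.                         *)
Definition jucys_murphy (i : nat) : hecke :=
  (\prod_(m <- rev (enum 'I_k) | (m < i)%N) sigma m) *
  (\prod_(m <- enum 'I_k | (m < i)%N) sigma m).

Definition primitive_idempotent (e : hecke) : Prop :=
  [/\ e != 0, e * e = e &
      forall f g, f * f = f -> g * g = g -> f * g = 0 -> g * f = 0 ->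
        e = f + g -> f = 0 \/ g = 0].

(* The image of x under sigma_i |-> R_i. When R satisfies the Yang-Baxter
   equation and the Hecke condition, the value does not depend on the
   representative of x.                                                       *)
Definition hecke_eval (n : nat) (R : tmx F n 2) (x : hecke) : tmx F n k.+1 :=
  feval (fun i : 'I_k => Rat R k i) (qrepr x : Hfree).

End HeckeAlgebra.

Section Tableaux.
Variable k : nat.

(* Partitions of k, padded by zeros to k parts. *)
Definition partn : finType :=
  {nu : {ffun 'I_k -> 'I_k.+1} |
    [forall i : 'I_k, forall j : 'I_k, (i <= j)%N ==> (nu j <= nu i)%N]
    && (\sum_i nu i == k)%N}.

(* T i is the box (row, column) containing i; all numbered from 0. *)
Definition is_standard (nu : partn) (T : {ffun 'I_k -> 'I_k * 'I_k}) : bool :=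
  [&& injectiveb T,
      [forall b, (b \in codom T) == (b.2 < val nu b.1)%N],
      [forall i, forall j,
        ((T i).1 == (T j).1) && ((T i).2 < (T j).2)%N ==> (i < j)%N] &
      [forall i, forall j,
        ((T i).2 == (T j).2) && ((T i).1 < (T j).1)%N ==> (i < j)%N]].

Definition stdtab (nu : partn) : finType :=
  {T : {ffun 'I_k -> 'I_k * 'I_k} | is_standard nu T}.

(* Pairs nu(a): a partition of k with a standard tableau of that shape. *)
Definition tab : finType := {nu : partn & stdtab nu}.

Definition content (t : tab) (i : 'I_k) : int :=
  let: (r, c) := val (tagged t) i in c%:Z - r%:Z.

End Tableaux.

Record qYoung_family (F : fieldType) (q : F) (k : nat) (Y : tab k.+1 -> hecke q k) :
    Prop := QYoungFamily {
  qY_primitive : forall t, primitive_idempotent (Y t);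
  qY_orthogonal : forall t u, t != u -> Y t * Y u = 0;
  qY_complete : \sum_t Y t = 1;
  qY_jmL : forall t (i : 'I_k.+1),
    jucys_murphy q k i * Y t = q ^ (2 * content t i) *: Y t;
  qY_jmR : forall t (i : 'I_k.+1),
    Y t * jucys_murphy q k i = q ^ (2 * content t i) *: Y t
}.

Section Components.
Variables (F : fieldType) (q : F) (k n : nat) (R : tmx F n 2).
Variable Y : tab k.+1 -> hecke q k.

Definition component (t : tab k.+1) : {vspace tvec F n k.+1} :=
  limg (mxact (hecke_eval R (Y t))).

(* f is the image of g under End(V_t) -> End(V^{(x) (k+1)}), the extension by
   zero on the other components.                                              *)
Definition zero_extension (t : tab k.+1) (g : 'End(subvs_of (component t)))
    (f : 'End(tvec F n k.+1)) : Prop :=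
  (forall w, f (vsval w) = vsval (g w)) /\
  (forall u, u != t -> forall v, v \in component u -> f v = 0).

End Components.

(* Main.v *)
From Stdlib Require Import Ncring Ncring_tac.
Require Import Defs.
From HB Require Import structures.
From mathcomp Require Import all_boot all_order all_algebra perm generic_quotient.
From mathcomp Require Import boolp reals complex finmap monalg ring zify.
Import Defs.

Set Implicit Arguments.
Unset Strict Implicit.
Unset Printing Implicit Defensive.

Import Order.TTheory GRing.Theory Num.Theory.
Local Open Scope ring_scope.

(** The generator l acts on the tensor power by the sum over s of operators
    X_s(l), where X_0(l) is the action on the first factor and
    X_(s+1)(l) = Q_s X_s(l) Q_s with Q_s the inverse of the R-matrix g_s in the
    factors s, s+1 (everything is numbered from 0). The proposition rests on
    three facts.

    The sum commutes with every g_m, hence with the image of the Hecke algebra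
    ([ladder_sum_comm]). By the braid relation g_m commutes with X_s unless s is
    m or m+1, and it commutes with X_m + Q_m X_m Q_m by the Hecke relation. So
    the images of the Young idempotents are stable, and compressing the action
    between idempotents is the same as restricting it.

    The sum satisfies the reflection relations ([reflection_ladder]). Write T
    for the R-matrix in the two auxiliary factors, L_s for the matrix with
    entries X_s(l), and [X, Y] = T X T Y - X T Y T. Let E_s collect
    [L_s, L_s] - (T L_s - L_s T) and the brackets of L_s with the earlier
    L_i. Since Q_s^2 = 1 - lambda Q_s, the bracket [L_(s+1), L_(s+1)] is the
    conjugate of [L_s, L_s] plus a correction, which cancels the brackets of
    L_(s+1) with L_s as soon as Z_s = L_s Q_s T L_s satisfies T Z_s = g_s Z_s
    and Z_s T = Z_s g_s ([refl_step]). Hence E_(s+1) = Q_s E_s Q_s, and the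
    whole relation reduces to E_0 = 0 and to the two identities for Z_0, which
    the braid relation carries along the ladder ([refl_cup]).

    At the start of the ladder the operator of l_i^j on the fundamental module
    has rank one, with image spanned by e_i, so that products of two generators
    collapse to partial traces: E_0 = 0 is Tr_1(B_1 R_12) = 1
    ([fundamental_trace]), and the identities for Z_0 follow from
    Tr_1(B_1 R_12 R_13^-1) = B_3 P_23 ([tr_block_RS]) and
    R B_1 B_2 = B_1 B_2 R ([Bmx2_comm_R]), all consequences of
    skew-invertibility and the Yang-Baxter equation.

    Finally, if two standard tableaux differ by exchanging i and i+1, a linear
    polynomial in sigma_i exchanges the two Jucys-Murphy eigenvalues and so
    intertwines the two idempotents ([Young_equiv_swap]); it is invertible as
    the two boxes lie on non-adjacent diagonals. Such exchanges connect all
    standard tableaux of a given shape ([tab_connected]). The intertwiner lies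
    in the Hecke algebra, so it commutes with the action of the generators. *)

(** * Evaluating free algebras and their quotients at matrices *)

Section FreeAlgebra.
Variables (F : fieldType) (X : choiceType) (N : nat) (f : X -> 'M[F]_N).
Implicit Types g : freealg F X.

Let wordval (w : fmonom X) : 'M[F]_N := \prod_(x <- val w) f x.

(** Evaluations of several polynomials can only be added termwise over a common
    set of words, whence the enlarged support. *)
Lemma feval_wider (d : {fset fmonom X}) g : (msupp g `<=` d)%fset ->
  feval f g = \sum_(w <- d) mcoeff w g *: wordval w.
Proof.
move=> le; rewrite [LHS](big_fset_incl _ le) => //= x xd /mcoeff_outdom ->.
by rewrite scale0r.
Qed.

Lemma feval_is_linear : linear (feval f).
Proof.
move=> c g1 g2; pose d := (msupp g1 `|` msupp g2)%fset.
have le1 : (msupp g1 `<=` d)%fset by exact: fsubsetUl.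
have le2 : (msupp g2 `<=` d)%fset by exact: fsubsetUr.
have le : (msupp (c *: g1 + g2 : freealg F X) `<=` d)%fset.
  apply: fsubset_trans (msuppD_le _ _) _; rewrite fsubUset le2 andbT.
  exact: fsubset_trans (msuppZ_le _ _) le1.
rewrite (feval_wider le) (feval_wider le1) (feval_wider le2) scaler_sumr.
rewrite -big_split; apply: eq_bigr => w _ /=.
by rewrite mcoeffD mcoeffZ scalerDl scalerA.
Qed.

HB.instance Definition _ :=
  GRing.isLinear.Build F (freealg F X) 'M[F]_N *:%R (feval f) feval_is_linear.

Lemma feval_word c (w : fmonom X) : feval f (mkmalgU w c : freealg F X) = c *: wordval w.
Proof. by rewrite (feval_wider msuppU_le) big_seq_fset1 mcoeffUU. Qed.

Lemma feval_is_monoid_morphism : monoid_morphism (feval f).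
Proof.
split=> [|g1 g2].
  change (feval f (@mkmalgU (fmonom X) F (mone : fmonom X) 1 : freealg F X) = 1); rewrite feval_word scale1r /wordval.
  by rewrite [val _]fm1 big_nil.
rewrite [_ * _](malgME (g1 : malg _ _) g2) raddf_sum /= [in RHS]/feval mulr_suml.
apply: eq_bigr => w1 _; rewrite raddf_sum mulr_sumr; apply: eq_bigr => w2 _ /=.
rewrite feval_word /wordval [val _]fmM big_cat /=.
by rewrite -[_ * _ in RHS]/(_ *m _) -scalemxAl -scalemxAr scalerA.
Qed.

HB.instance Definition _ :=
  GRing.isMonoidMorphism.Build (freealg F X) 'M[F]_N (feval f) feval_is_monoid_morphism.

Lemma feval_gen x : feval f (fgen F x) = f x.
Proof. by rewrite feval_word scale1r /wordval /= fmuE big_seq1. Qed.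

Lemma feval_scalar c : feval f (c%:A : freealg F X) = c%:M.
Proof. by rewrite linearZ rmorph1; apply: scalemx1. Qed.

Let fevalM g h : feval f (g * h) = feval f g *m feval f h.
Proof. exact: feval_is_monoid_morphism.2. Qed.

Let fevalD g h : feval f (g + h) = feval f g + feval f h.
Proof. exact: raddfD. Qed.

Let fevalB g h : feval f (g - h) = feval f g - feval f h.
Proof. exact: raddfB. Qed.

Lemma feval_braid x y :
  feval f (fgen F x * fgen F y * fgen F x - fgen F y * fgen F x * fgen F y : freealg F X) =
  f x *m f y *m f x - f y *m f x *m f y.
Proof.
rewrite -(feval_gen x) -(feval_gen y); move: (fgen F x) (fgen F y) => a b.
by rewrite fevalB !fevalM.
Qed.

Lemma feval_commutator x y :
  feval f (fgen F x * fgen F y - fgen F y * fgen F x : freealg F X) =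
  f x *m f y - f y *m f x.
Proof.
rewrite -(feval_gen x) -(feval_gen y); move: (fgen F x) (fgen F y) => a b.
by rewrite fevalB !fevalM.
Qed.

Lemma feval_quadratic x c d :
  feval f ((fgen F x - c%:A) * (fgen F x + d%:A) : freealg F X) =
  (f x - c%:M) *m (f x + d%:M).
Proof.
rewrite -(feval_gen x) -(feval_scalar c) -(feval_scalar d).
move: (fgen F x) (c%:A) (d%:A) => a b e.
by rewrite fevalM fevalB fevalD.
Qed.

Lemma feval_comm (C : 'M[F]_N) g :
  (forall x, f x *m C = C *m f x) -> feval f g *m C = C *m feval f g.
Proof.
move=> fC; rewrite mulmx_suml mulmx_sumr; apply: eq_bigr => w _.
rewrite -scalemxAl -scalemxAr; congr (_ *: _).
elim: (val w) => [|x l IH]; first by rewrite big_nil -[1]/(1%:M) mul1mx mulmx1.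
by rewrite big_cons -[_ * _]/(_ *m _) -mulmxA IH !mulmxA fC.
Qed.

End FreeAlgebra.

Section QuotientEvaluation.
Variables (F : fieldType) (X : choiceType) (N : nat) (f : X -> 'M[F]_N).
Variable (S : freealg F X -> Prop).
Hypothesis fS : forall x, S x -> feval f x = 0.

Let ev (x : qalg S) := feval f (qrepr x).

(** The evaluation at a chosen representative is a ring morphism because the
    kernel of the evaluation is an ideal that contains the relations. *)
Lemma qeval_pi (x : freealg F X) : ev (qpi S x) = feval f x.
Proof.
apply/eqP; rewrite -subr_eq0 -raddfB; apply/eqP.
have /asboolP/(_ (fun y => feval f y = 0)) := qrepr_pi S x; apply; last by [].
split=> [|y z fy fz|a y fy]; rewrite ?raddf0 ?raddfD /= ?fy ?fz ?addr0 //.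
by rewrite !rmorphM /= fy mulr0 mul0r.
Qed.

Lemma qeval_linear c (x y : qalg S) : ev (c *: x + y) = c *: ev x + ev y.
Proof.
rewrite -[x]qreprK -[y]qreprK -[_ *: _]qpiZ -qpiD !qeval_pi.
exact: linearP.
Qed.

Lemma qeval1 : ev 1 = 1.
Proof. by rewrite [LHS]qeval_pi rmorph1. Qed.

Lemma qevalM (x y : qalg S) : ev (x * y) = ev x * ev y.
Proof.
by rewrite -[x]qreprK -[y]qreprK -[_ * _ in LHS]qpiM !qeval_pi rmorphM.
Qed.

End QuotientEvaluation.

(** * Matrices embedded in chosen tensor factors *)

Section TensorEntries.
Variables (T : nmodType) (n k : nat).
Implicit Types (X Y : tmx T n k) (I J : widx n k).

Lemma ent_tmx_of (E : widx n k -> widx n k -> T) I J : ent (tmx_of E) I J = E I J.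
Proof. by rewrite /ent mxE !enum_rankK. Qed.

Lemma tmxP X Y : (forall I J, ent X I J = ent Y I J) -> X = Y.
Proof.
move=> e; apply/matrixP => a b.
by have := e (enum_val a) (enum_val b); rewrite /ent !enum_valK.
Qed.

Lemma entD X Y I J : ent (X + Y) I J = ent X I J + ent Y I J.
Proof. by rewrite /ent mxE. Qed.
Lemma ent0 I J : ent (0 : tmx T n k) I J = 0.
Proof. by rewrite /ent mxE. Qed.
End TensorEntries.

Lemma big_widx (T : nmodType) n k (F : 'I_#|widx n k| -> T) :
  \sum_a F a = \sum_(K : widx n k) F (enum_rank K).
Proof.
by rewrite (reindex (@enum_rank (widx n k))) //; exists enum_val => x _; rewrite ?enum_rankK ?enum_valK.
Qed.

Lemma ent_mul (T : pzSemiRingType) n k (X Y : tmx T n k) I J :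
  ent (X *m Y) I J = \sum_K ent X I K * ent Y K J.
Proof. by rewrite /ent mxE big_widx. Qed.

Lemma ent_scalar (T : pzSemiRingType) n k (c : T) (I J : widx n k) :
  ent (c%:M : tmx T n k) I J = c *+ (I == J).
Proof. by rewrite /ent mxE (inj_eq enum_rank_inj). Qed.

Lemma entZ (T : pzSemiRingType) n k (c : T) (X : tmx T n k) I J :
  ent (c *: X) I J = c * ent X I J.
Proof. by rewrite /ent mxE. Qed.

Section Embedding.
Variables (n : nat).

Definition agree_off m k (f : 'I_m -> 'I_k) (I J : widx n k) :=
  [forall c, (c \notin codom f) ==> (I c == J c)].

Definition wrestr m k (f : 'I_m -> 'I_k) (I : widx n k) : widx n m := [ffun a => I (f a)].

Lemma agree_offP m k (f : 'I_m -> 'I_k) (I J : widx n k) :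
  reflect (forall c, c \notin codom f -> I c = J c) (agree_off f I J).
Proof.
apply: (iffP forallP) => h c; last by apply/implyP => cf; rewrite h.
by move=> cf; apply/eqP; apply: (implyP (h c)).
Qed.

Lemma ent_emb (T : nmodType) m k (f : 'I_m -> 'I_k) (X : tmx T n m) I J :
  ent (emb f X) I J = if agree_off f I J then ent X (wrestr f I) (wrestr f J) else 0.
Proof. by rewrite ent_tmx_of. Qed.

Lemma eq_emb (T : nmodType) m k (f g : 'I_m -> 'I_k) (X : tmx T n m) :
  f =1 g -> emb f X = emb g X.
Proof.
move=> fg; apply: tmxP => I J; rewrite !ent_emb.
have w K : wrestr f K = wrestr g K by apply/ffunP => a; rewrite !ffunE fg.
rewrite !w; suff -> : agree_off f I J = agree_off g I J by [].
by apply: eq_forallb => c; rewrite (eq_codom fg).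
Qed.

Definition wplug m k (f : 'I_m -> 'I_k) (I : widx n k) (A : widx n m) : widx n k :=
  [ffun c => if [pick a | f a == c] is Some a then A a else I c].

Lemma wplug_out m k (f : 'I_m -> 'I_k) I A c : c \notin codom f -> wplug f I A c = I c.
Proof.
move=> cf; rewrite ffunE; case: pickP => // a /eqP fa.
by rewrite -fa codom_f in cf.
Qed.

Lemma wplug_in m k (f : 'I_m -> 'I_k) I A a : injective f -> wplug f I A (f a) = A a.
Proof.
move=> fI; rewrite ffunE; case: pickP => [b /eqP/fI->//|/(_ a)].
by rewrite eqxx.
Qed.

Lemma wrestrK m k (f : 'I_m -> 'I_k) I K :
  injective f -> agree_off f I K -> wplug f I (wrestr f K) = K.
Proof.
move=> fI /agree_offP ag; apply/ffunP => c.
have [/codomP[a ->]|cf] := boolP (c \in codom f); first by rewrite wplug_in // ffunE.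
by rewrite wplug_out // ag.
Qed.

Lemma wplugK m k (f : 'I_m -> 'I_k) I A : injective f -> wrestr f (wplug f I A) = A.
Proof. by move=> fI; apply/ffunP => a; rewrite ffunE wplug_in. Qed.

Lemma agree_plug m k (f : 'I_m -> 'I_k) I A : agree_off f I (wplug f I A).
Proof. by apply/agree_offP => c cf; rewrite wplug_out. Qed.

(** Only intermediate words that agree with I off the image of f contribute to
    the product; [wplug] identifies them with the words on the small space. *)
Lemma emb_mul (T : pzSemiRingType) m k (f : 'I_m -> 'I_k) (X Y : tmx T n m) :
  injective f -> emb f (X *m Y) = emb f X *m emb f Y.
Proof.
move=> fI; apply: tmxP => I J; rewrite ent_mul ent_emb.
transitivity (\sum_(K | agree_off f I K)
   (if agree_off f I J then ent X (wrestr f I) (wrestr f K) * ent Y (wrestr f K) (wrestr f J) else 0)).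
  rewrite (reindex_onto (wplug f I) (wrestr f)) /=; last by move=> K; apply: wrestrK.
  rewrite (eq_bigl xpredT); last by move=> A; rewrite agree_plug wplugK ?eqxx.
  case: ifP => _; last by rewrite big1.
  by rewrite ent_mul; apply: eq_bigr => A _; rewrite wplugK.
rewrite big_mkcond; apply: eq_bigr => K _; rewrite !ent_emb.
case: ifP => [/agree_offP IK|_]; last by rewrite mul0r.
have -> : agree_off f I J = agree_off f K J.
  by apply/agree_offP/agree_offP => h c cf; rewrite -h // IK.
by case: ifP; rewrite ?mulr0.
Qed.

Lemma emb_is_linear (T : pzRingType) m k (f : 'I_m -> 'I_k) :
  linear (emb f : tmx T n m -> tmx T n k).
Proof.
move=> c X Y; apply: tmxP => I J; rewrite !(entD, entZ, ent_emb).
by case: ifP => _; rewrite ?mulr0 ?addr0 // entD entZ.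
Qed.

Lemma emb1 (T : pzSemiRingType) m k (f : 'I_m -> 'I_k) :
  emb f (1%:M : tmx T n m) = 1%:M.
Proof.
apply: tmxP => I J; rewrite ent_emb !ent_scalar; case: (altP (I =P J)) => [->|IJ].
  by rewrite eqxx ifT //; apply/agree_offP.
case: ifP => // /agree_offP ag; rewrite (negPf (_ : wrestr f I != wrestr f J)) //.
apply: contra IJ => /eqP e; apply/eqP/ffunP => c.
have [/codomP[a ->]|/ag//] := boolP (c \in codom f).
by have /ffunP/(_ a) := e; rewrite !ffunE.
Qed.

Lemma emb_comp (T : nmodType) l m k (f : 'I_m -> 'I_k) (g : 'I_l -> 'I_m) (X : tmx T n l) :
  injective f -> emb f (emb g X) = emb (f \o g) X.
Proof.
move=> fI; apply: tmxP => I J; rewrite !ent_emb.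
have wc K : wrestr g (wrestr f K) = wrestr (f \o g) K by apply/ffunP => a; rewrite !ffunE.
rewrite !wc; have -> : agree_off (f \o g) I J =
    agree_off f I J && agree_off g (wrestr f I) (wrestr f J).
  apply/agree_offP/andP => [ag|[/agree_offP agf /agree_offP agg] c cfg].
    split; apply/agree_offP => c cf; last first.
      by rewrite !ffunE ag //; apply: contra cf => /codomP[a /fI->]; apply: codom_f.
    by apply: ag; apply: contra cf => /codomP[a ->]; apply: codom_f.
  have [/codomP[b cb]|/agf//] := boolP (c \in codom f).
  have := agg b; rewrite !ffunE -cb; apply; apply: contra cfg => /codomP[a ba].
  by rewrite cb ba; apply: (codom_f (f \o g) a).
by case: ifP.
Qed.

(** A single intermediate word contributes: it must follow J on the image of f
    and I elsewhere. *)
Lemma ent_emb_disjoint (T : pzSemiRingType) l m k (f : 'I_m -> 'I_k) (g : 'I_l -> 'I_k)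
    (X : tmx T n m) (Y : tmx T n l) I J :
  injective f -> (forall a b, f a != g b) ->
  ent (emb f X *m emb g Y) I J =
  if [forall c, (c \notin codom f) && (c \notin codom g) ==> (I c == J c)]
  then ent X (wrestr f I) (wrestr f J) * ent Y (wrestr g I) (wrestr g J) else 0.
Proof.
move=> fI fg; rewrite ent_mul.
pose K0 := wplug f I (wrestr f J).
have gf b : g b \notin codom f.
  by apply/negP => /codomP[a e]; have := fg a b; rewrite e eqxx.
rewrite (bigD1 K0) //= big1 ?addr0; last first.
  move=> K /eqP KK; rewrite !ent_emb; case: ifP => [agf|_]; last by rewrite mul0r.
  case: ifP => [/agree_offP agg|_]; last by rewrite mulr0.
  case: KK; rewrite -(wrestrK fI agf); congr (wplug _ _ _); apply/ffunP => a.
  by rewrite !ffunE agg //; apply/negP => /codomP[b e]; have := fg a b; rewrite e eqxx.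
rewrite !ent_emb agree_plug wplugK //.
have -> : wrestr g K0 = wrestr g I.
  by apply/ffunP => b; rewrite [LHS]ffunE [RHS]ffunE /K0 wplug_out.
have -> : agree_off g K0 J =
   [forall c, (c \notin codom f) && (c \notin codom g) ==> (I c == J c)].
  apply/agree_offP/forallP => h c.
    by apply/implyP => /andP[cf cg]; rewrite -(h c cg) wplug_out.
  move=> cg; have [/codomP[a ->]|cf] := boolP (c \in codom f).
    by rewrite wplug_in // ffunE.
  by rewrite wplug_out //; have := h c; rewrite cf cg => /eqP.
by case: ifP; rewrite ?mulr0.
Qed.

Lemma emb_comm (T : comPzRingType) l m k (f : 'I_m -> 'I_k) (g : 'I_l -> 'I_k)
    (X : tmx T n m) (Y : tmx T n l) :
  injective f -> injective g -> (forall a b, f a != g b) ->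
  emb f X *m emb g Y = emb g Y *m emb f X.
Proof.
move=> fI gI fg; have gf a b : g a != f b by rewrite eq_sym.
apply: tmxP => I J; rewrite !ent_emb_disjoint // mulrC; congr (if _ then _ else _).
by apply: eq_forallb => c; rewrite andbC.
Qed.
End Embedding.

(** * Reflection equation along a ladder of Hecke conjugations *)

Section NoncommutativeRing.
Variable A : pzRingType.

(** With these instances [non_commutative_ring] proves identities of
    noncommutative polynomials in any ring. *)
#[export] Instance pzRing_ops :
  @Ncring.Ring_ops A 0 1 +%R *%R (fun x y => x - y) (@GRing.opp A) eq := {}.

#[export] Instance pzRing_ncring : Ncring.Ring (Ro := pzRing_ops).
Proof.
constructor; try exact _; try (by move=> ? ? -> ? ? ->); try (by move=> ? ? ->).
- exact: add0r.
- exact: addrC.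
- exact: addrA.
- exact: mul1r.
- exact: mulr1.
- exact: mulrA.
- exact: mulrDl.
- by move=> x y z; apply: mulrDr.
- by [].
- exact: subrr.
Qed.

End NoncommutativeRing.

(** The common shape of the Jucys-Murphy elements and of the operators by which a
    generator acts on a tensor power: a sequence built from its first term by
    conjugation-like steps L_(s+1) = g_s L_s g_s. *)
Section Ladder.
Variables (A : pzRingType) (k : nat) (g L : nat -> A).
Hypothesis braid : forall i, (i.+1 < k)%N -> g i * g i.+1 * g i = g i.+1 * g i * g i.+1.
Hypothesis far : forall i j, (i.+1 < j < k)%N -> g i * g j = g j * g i.
Hypothesis LS : forall s, (s < k)%N -> L s.+1 = g s * L s * g s.
Hypothesis comm0 : forall m, (0 < m < k)%N -> g m * L 0%N = L 0%N * g m.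

Lemma ladder_comm_above s m : (s < m < k)%N -> g m * L s = L s * g m.
Proof.
elim: s => [|s IH] in m *; first exact: comm0.
case/andP=> sm mk; have sk : (s < k)%N by apply: ltn_trans mk; apply: ltnW.
rewrite LS // !mulrA -far ?sm // -(mulrA (g s)) IH ?mk ?(ltnW sm) //.
by rewrite -!mulrA [g s * g m]far ?sm.
Qed.

(** At s = m+2 the braid relation moves g_m through g_(m+1) g_m on the left,
    where it becomes g_(m+1), commutes with L_m, and turns back into g_m on the
    right; the later steps involve only generators far from g_m. *)
Lemma ladder_comm_below s m : (m.+1 < s <= k)%N -> g m * L s = L s * g m.
Proof.
elim: s => [|s IH]; first by rewrite ltn0.
rewrite ltnS leq_eqVlt => /andP[/orP[/eqP<- mk|ms sk]].
  have mk' : (m < k)%N by apply: ltnW.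
  rewrite LS // (LS mk') !mulrA (braid mk) -!mulrA (mulrA (g m) _ (g m)) (braid mk).
  have := @ladder_comm_above m m.+1; rewrite leqnn mk => /(_ isT) c.
  by rewrite -!mulrA [L m * (g m.+1 * _)]mulrA -c !mulrA.
rewrite LS // !mulrA far ?ms // -!mulrA -(far (i := m)) ?ms // (mulrA (g m)) IH.
  by rewrite -!mulrA.
by rewrite ms ltnW.
Qed.

Variable lam : A.
Hypothesis lamg : forall m, (m < k)%N -> lam * g m = g m * lam.
Hypothesis lamL : forall s, (s <= k)%N -> lam * L s = L s * lam.
Hypothesis quad : forall m, (m < k)%N -> g m * g m = 1 - lam * g m.

(** All terms other than L_m and L_(m+1) commute with g_m separately. For these
    two, g_m^2 = 1 - lam g_m makes g_m (L_m + g_m L_m g_m) equal to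
    g_m L_m + L_m g_m - lam g_m L_m g_m, which is symmetric. *)
Lemma ladder_sum_comm m : (m < k)%N ->
  g m * (\sum_(s < k.+1) L s) = (\sum_(s < k.+1) L s) * g m.
Proof.
move=> mk; rewrite -!(big_mkord xpredT L).
rewrite (big_cat_nat (n := m)) //=; last by apply: leq_trans (ltnW mk) _.
rewrite [X in _ + X](big_cat_nat (n := m.+2)) //=; last by rewrite leqW.
rewrite (big_nat_recr m.+1) ?leqW // big_nat1 /= LS //.
have cm (a b : nat) : (forall i, (a <= i < b)%N -> g m * L i = L i * g m) ->
    g m * (\sum_(a <= i < b) L i) = (\sum_(a <= i < b) L i) * g m.
  by move=> h; rewrite mulr_sumr mulr_suml; apply: eq_big_nat.
rewrite !mulrDr !mulrDl !cm; first last.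
- by move=> i /andP[_ im]; apply: ladder_comm_above; rewrite im.
- by move=> i /andP[im ik]; apply: ladder_comm_below; rewrite im.
congr (_ + (_ + _)).
have e : lam * g m * L m * g m = g m * L m * (lam * g m).
  rewrite lamg // -!mulrA; congr (_ * _); rewrite mulrA (lamL (ltnW mk)) -mulrA.
  by rewrite lamg.
rewrite (_ : g m * (g m * L m * g m) = (g m * g m) * L m * g m); last by rewrite !mulrA.
rewrite (_ : g m * L m * g m * g m = g m * L m * (g m * g m)); last by rewrite !mulrA.
rewrite quad // !mulrBl mulrBr e.
by non_commutative_ring.
Qed.
End Ladder.

Section ReflectionRecursion.
Variable A : pzRingType.

(** The quadratic part of the reflection equation, polarized in L. *)
Definition refl_bracket (T X Y : A) := T * X * T * Y - X * T * Y * T.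

(** The inductive step of the ladder. Q^2 = 1 - lam Q splits the diagonal term
    for L' into a conjugate of the one for L and the correction
    - lam Q (T Z - Z T) Q; the relations between T and Z turn the cross terms
    into Q^2 Z - Z Q^2, which is the opposite of that correction. *)
Lemma refl_step (T Q L lam : A) :
  lam * T = T * lam -> lam * Q = Q * lam -> lam * L = L * lam ->
  T * Q = Q * T -> Q * Q = 1 - lam * Q ->
  let Z := L * Q * T * L in
  T * Z = (Q + lam) * Z -> Z * T = Z * (Q + lam) ->
  let L' := Q * L * Q in
  refl_bracket T L' L' - (T * L' - L' * T) + (refl_bracket T L L' + refl_bracket T L' L) =
  Q * (refl_bracket T L L - (T * L - L * T)) * Q.
Proof.
move=> lT lQ lL TQ QQ Z TZ ZT L'.
have diag : refl_bracket T L' L' =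
    Q * refl_bracket T L L * Q - lam * (Q * (T * Z - Z * T) * Q).
  have -> : refl_bracket T L' L' = Q * (T * L * (Q * Q) * T * L - L * (Q * Q) * T * L * T) * Q.
    rewrite /refl_bracket /L' !mulrBr !mulrBl; congr (_ - _); rewrite !mulrA.
      by rewrite TQ -!mulrA (mulrA T Q) TQ !mulrA.
    by rewrite -!mulrA TQ (mulrA T Q) TQ -!mulrA.
  have -> : lam * (Q * (T * Z - Z * T) * Q) = Q * (lam * T * Z - lam * Z * T) * Q.
    by rewrite -(mulrA lam) -(mulrA lam) -mulrBr !mulrA lQ.
  rewrite QQ /refl_bracket /Z lT -!mulrA.
  have e1 : lam * (L * (Q * (T * L))) = L * (lam * (Q * (T * L))) by rewrite mulrA lL -mulrA.
  have e2 : lam * (L * (Q * (T * (L * T)))) = L * (lam * (Q * (T * (L * T)))).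
    by rewrite mulrA lL -mulrA.
  by rewrite e1 e2; non_commutative_ring.
have cross : refl_bracket T L L' + refl_bracket T L' L = lam * (Q * (T * Z - Z * T) * Q).
  have -> : refl_bracket T L L' = T * Z * Q - Z * T * Q.
    rewrite /refl_bracket /L' /Z -!mulrA TQ; congr (_ - _); last by rewrite (mulrA T) TQ -!mulrA.
    by rewrite (mulrA T Q) TQ -!mulrA.
  have -> : refl_bracket T L' L = Q * (T * Z) - Q * (Z * T).
    rewrite /refl_bracket /L' /Z -!mulrA; congr (_ - _).
    by rewrite mulrA TQ -!mulrA.
  rewrite TZ ZT.
  have -> : lam * (Q * ((Q + lam) * Z - Z * (Q + lam)) * Q) =
     lam * ((Q * Q) * Z * Q - Q * Z * (Q * Q)) + lam * Q * (lam * Z - Z * lam) * Q.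
    non_commutative_ring.
  have lZ : lam * Z = Z * lam.
    rewrite /Z !mulrA lL -!mulrA; congr (_ * _).
    by rewrite mulrA lQ -!mulrA; congr (_ * _); rewrite mulrA lT -!mulrA lL.
  have -> : (Q + lam) * Z * Q - Z * (Q + lam) * Q + (Q * ((Q + lam) * Z) - Q * (Z * (Q + lam)))
    = (lam * Z - Z * lam) * Q + Q * (lam * Z - Z * lam) + (Q * Q) * Z - Z * (Q * Q).
    by non_commutative_ring.
  rewrite lZ subrr QQ mulr0 !mul0r !addr0 mulr0 add0r.
  have e : Z * (1 - lam * Q) = Z - lam * Z * Q by rewrite mulrBr mulr1 mulrA lZ.
  have e' : Q * Z * (1 - lam * Q) = Q * Z - lam * Q * Z * Q.
    by rewrite mulrBr mulr1 mulrA -(mulrA Q Z) -lZ !mulrA lQ.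
  rewrite e e'; non_commutative_ring.
rewrite diag cross addrAC subrK; move: (refl_bracket T L L) => br.
rewrite mulrBr mulrBl; congr (_ - _); rewrite /L' mulrBr mulrBl !mulrA TQ; congr (_ - _).
by rewrite -!mulrA TQ.
Qed.

Lemma refl_bracketDl T X Y Z : refl_bracket T (X + Y) Z = refl_bracket T X Z + refl_bracket T Y Z.
Proof. by rewrite /refl_bracket; non_commutative_ring. Qed.

Lemma refl_bracketDr T X Y Z : refl_bracket T Z (X + Y) = refl_bracket T Z X + refl_bracket T Z Y.
Proof. by rewrite /refl_bracket; non_commutative_ring. Qed.

Variables (k : nat) (T lam : A) (Q L : nat -> A).
Hypothesis braid : forall i, (i.+1 < k)%N -> Q i * Q i.+1 * Q i = Q i.+1 * Q i * Q i.+1.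
Hypothesis far : forall i j, (i.+1 < j < k)%N -> Q i * Q j = Q j * Q i.
Hypothesis LS : forall s, (s < k)%N -> L s.+1 = Q s * L s * Q s.
Hypothesis comm0 : forall m, (0 < m < k)%N -> Q m * L 0%N = L 0%N * Q m.
Hypothesis lamT : lam * T = T * lam.
Hypothesis lamQ : forall m, (m < k)%N -> lam * Q m = Q m * lam.
Hypothesis lamL : forall s, (s <= k)%N -> lam * L s = L s * lam.
Hypothesis TQ : forall m, (m < k)%N -> T * Q m = Q m * T.
Hypothesis quad : forall m, (m < k)%N -> Q m * Q m = 1 - lam * Q m.
Hypothesis refl0 : refl_bracket T (L 0%N) (L 0%N) = T * L 0%N - L 0%N * T.

Let Z s := L s * Q s * T * L s.
Hypothesis TZ0 : (0 < k)%N -> T * Z 0%N = (Q 0%N + lam) * Z 0%N.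
Hypothesis ZT0 : (0 < k)%N -> Z 0%N * T = Z 0%N * (Q 0%N + lam).

(** Q_s Q_(s+1) Q_s appears in the middle of Z_(s+1); after the braid move its
    outer factors Q_(s+1) commute with L_s and can be pulled out. *)
Lemma refl_cup_step s : (s.+1 < k)%N -> Z s.+1 = Q s * Q s.+1 * Z s * Q s.+1 * Q s.
Proof.
move=> sk; have sk' := ltnW sk.
have QL : Q s.+1 * L s = L s * Q s.+1.
  by apply: (ladder_comm_above far LS comm0); rewrite leqnn.
rewrite /Z LS //.
rewrite (_ : _ * T * _ = Q s * L s * (Q s * Q s.+1 * Q s) * T * L s * Q s).
  rewrite braid // -!mulrA (mulrA (L s) (Q s.+1)) -QL -!mulrA.
  do 4! congr (_ * _); rewrite !mulrA -TQ // -!mulrA; congr (_ * _).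
  by rewrite !mulrA QL.
by rewrite -!mulrA (mulrA T (Q s)) TQ // -!mulrA.
Qed.

(** Q_s Q_(s+1) intertwines Q_s with Q_(s+1), so the relations between T and Z_s
    are transported to Z_(s+1). *)
Lemma refl_cup s : (s < k)%N ->
  T * Z s = (Q s + lam) * Z s /\ Z s * T = Z s * (Q s + lam).
Proof.
elim: s => [|s IH] sk; first by split; [apply: TZ0|apply: ZT0].
have [TZ ZT] := IH (ltnW sk); have sk' := ltnW sk; rewrite refl_cup_step //; split.
  have -> : T * (Q s * Q s.+1 * Z s * Q s.+1 * Q s) = Q s * Q s.+1 * (T * Z s) * Q s.+1 * Q s.
    by rewrite !mulrA TQ // -(mulrA (Q s) T) TQ // !mulrA.
  rewrite TZ mulrDl mulrDr !mulrDl !mulrA braid //; congr (_ + _).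
  by rewrite -(mulrA (Q s) (Q s.+1) lam) -lamQ // mulrA -lamQ.
have -> : Q s * Q s.+1 * Z s * Q s.+1 * Q s * T = Q s * Q s.+1 * (Z s * T) * Q s.+1 * Q s.
  by rewrite -!mulrA -TQ // (mulrA (Q s.+1) T) -TQ // -!mulrA.
rewrite ZT !mulrDr !mulrDl !mulrA; congr (_ + _).
  by rewrite -!mulrA (mulrA (Q s) (Q s.+1) (Q s)) braid // -!mulrA.
by rewrite -!mulrA (mulrA lam) lamQ // -!mulrA lamQ.
Qed.

(** E_s gathers the terms of the reflection equation in which s is the largest
    index. For indices below s the brackets with L_(s+1) are plain conjugates
    of those with L_s, and [refl_step] deals with the rest: E_(s+1) is the
    conjugate of E_s, hence zero. *)
Theorem reflection_ladder :
  let X := \sum_(s < k.+1) L s in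
  refl_bracket T X X = T * X - X * T.
Proof.
pose P s : A := \sum_(i < s) L i.
have [E EE] : exists E : nat -> A, forall s,
    E s = refl_bracket T (L s) (L s) - (T * L s - L s * T)
          + (refl_bracket T (P s) (L s) + refl_bracket T (L s) (P s)) by eexists.
have PS s : P s.+1 = P s + L s by rewrite /P big_ord_recr.
have QP s : (s < k)%N -> Q s * P s = P s * Q s.
  move=> sk; rewrite mulr_sumr mulr_suml; apply: eq_bigr => i _.
  by apply: (ladder_comm_above far LS comm0); rewrite ltn_ord.
have E0 s : (s <= k)%N -> E s = 0.
  elim: s => [|s IH] sk.
    by rewrite EE /P big_ord0 refl0 subrr /refl_bracket !(mulr0, mul0r, subr0, addr0).
  have [TZ ZT] := refl_cup sk.
  have st := refl_step lamT (lamQ sk) (lamL (ltnW sk)) (TQ sk) (quad sk) TZ ZT.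
  suff -> : E s.+1 = Q s * E s * Q s by rewrite (IH (ltnW sk)) mulr0 mul0r.
  rewrite EE PS refl_bracketDl refl_bracketDr LS //.
  have -> (a b c d e : A) : a + (b + c + (d + e)) = (a + (c + e)) + (b + d).
    by non_commutative_ring.
  rewrite st EE [in RHS]mulrDr [in RHS]mulrDl; congr (_ + _).
  have QPs := QP s sk; have QTs := esym (TQ sk).
  have QPx x : Q s * (P s * x) = P s * (Q s * x) by rewrite mulrA QPs mulrA.
  have QTx x : Q s * (T * x) = T * (Q s * x) by rewrite mulrA QTs mulrA.
  rewrite /refl_bracket mulrDr mulrDl !mulrBr !mulrBl; congr (_ - _ + (_ - _));
    by rewrite -!mulrA ?(QTx, QPx, QTs, QPs).
have XS m : (m <= k)%N ->
    refl_bracket T (P m.+1) (P m.+1) = T * P m.+1 - P m.+1 * T.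
  elim: m => [|m IH] mk; first by rewrite PS /P big_ord0 add0r.
  have := E0 _ mk; rewrite EE (PS m.+1) refl_bracketDl !refl_bracketDr IH 1?ltnW //.
  move=> /eqP; rewrite addrAC subr_eq add0r => /eqP e.
  have -> (a b c d : A) : a + b + (c + d) = a + (d + (b + c)) by non_commutative_ring.
  by rewrite e; non_commutative_ring.
exact: XS.
Qed.

End ReflectionRecursion.

(** * The Hecke algebra relations of an R-matrix *)

Section Positions.
Variables (T : comPzRingType) (n : nat).

Definition pos k i m (a : 'I_m) : 'I_k.+1 := inord (i + a).

Lemma pos_inj k i m : (i + m <= k.+1)%N -> injective (@pos k i m).
Proof.
move=> h a b /(congr1 val); rewrite /= !inordK; first by move/addnI/val_inj.
  by apply: leq_trans h; rewrite ltn_add2l.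
by apply: leq_trans h; rewrite ltn_add2l.
Qed.

Lemma pos_comp k i m j l : (j + l <= m.+1)%N ->
  @pos k i m.+1 \o @pos m j l =1 @pos k (i + j) l.
Proof.
move=> h a; rewrite /pos /= inordK ?addnA //.
by apply: leq_trans h; rewrite ltn_add2l.
Qed.

Lemma tnth_pos k i : tnth [tuple inord i; inord i.+1] =1 @pos k i 2.
Proof.
move=> a; case: (unliftP ord0 a) => [b|] ->; rewrite /pos (tnth_nth ord0) /=.
  by rewrite ord1 /= addn1.
by rewrite addn0.
Qed.

Lemma emb_pos_comp k i m j l (X : tmx T n l) :
  (i + m.+1 <= k.+1)%N -> (j + l <= m.+1)%N ->
  emb (@pos k i m.+1) (emb (@pos m j l) X) = emb (@pos k (i + j) l) X.
Proof.
by move=> h h'; rewrite emb_comp; [apply/eq_emb/pos_comp|apply: pos_inj].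
Qed.
End Positions.
Arguments pos : clear implicits.

Section HeckeRMatrix.
Variables (F : fieldType) (n : nat) (q : F) (R : tmx F n 2).

Lemma Rat_pos (X : tmx F n 2) k i : Rat X k i = emb (pos k i 2) X.
Proof. exact/eq_emb/tnth_pos. Qed.

Hypothesis q0 : q != 0.
Hypothesis hecke : hecke_condition q R.
Let lam := q - q^-1.

Lemma hecke_quad : R *m R = 1%:M + lam *: R.
Proof.
apply/eqP; rewrite -subr_eq0 -[X in _ == X]hecke; apply/eqP.
rewrite mulmxDr mul_mx_scalar mulmxBl mul_scalar_mx scalerBr scale_scalar_mx mulVf //.
have AC (a b c d : tmx F n 2) : a - (d + (b - c)) = a - b + (c - d).
  by rewrite !opprD opprK -[RHS]addrA; congr (_ + _); rewrite addrCA [c - d]addrC.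
by rewrite /lam scalerBl AC.
Qed.


Lemma hecke_inv : R *m (R - lam%:M) = 1%:M.
Proof. by rewrite mulmxBr hecke_quad mul_mx_scalar addrK. Qed.

Lemma hecke_unit : R \in unitmx.
Proof. by case: (mulmx1_unit hecke_inv). Qed.

Lemma hecke_invmx : invmx R = R - lam%:M.
Proof. by rewrite -[RHS](mulKmx hecke_unit) hecke_inv mulmx1. Qed.

Lemma hecke_quad_inv : invmx R *m invmx R = 1%:M - lam *: invmx R.
Proof.
rewrite {2}hecke_invmx mulmxBr mulVmx ?hecke_unit //.
by rewrite mul_mx_scalar.
Qed.

Lemma Rat_inj k i : (i < k)%N -> injective (pos k i 2).
Proof. by move=> ik; apply: pos_inj; rewrite addn2 ltnS. Qed.

Lemma Rat_mul (X Y : tmx F n 2) k i : (i < k)%N -> Rat (X *m Y) k i = Rat X k i *m Rat Y k i.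
Proof. by move=> ik; rewrite !Rat_pos emb_mul //; apply: Rat_inj. Qed.

Lemma Rat1 k i : Rat (1%:M : tmx F n 2) k i = 1%:M.
Proof. by rewrite Rat_pos emb1. Qed.

Lemma Rat_linear c (X Y : tmx F n 2) k i : Rat (c *: X + Y) k i = c *: Rat X k i + Rat Y k i.
Proof. exact: emb_is_linear. Qed.

Lemma RatZ c (X : tmx F n 2) k i : Rat (c *: X) k i = c *: Rat X k i.
Proof.
have e0 : Rat (0 : tmx F n 2) k i = 0.
  by apply: tmxP => I J; rewrite ent_emb !ent0 if_same.
by rewrite -[c *: X]addr0 Rat_linear e0 addr0.
Qed.

Lemma Rat_sum (J : Type) (r : seq J) (X : J -> tmx F n 2) k i :
  Rat (\sum_(j <- r) X j) k i = \sum_(j <- r) Rat (X j) k i.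
Proof.
elim: r => [|j r IH].
  by rewrite !big_nil -[0 in LHS](scale0r 1%:M) RatZ scale0r.
by rewrite !big_cons -[X j in LHS]scale1r Rat_linear scale1r IH.
Qed.

Lemma Rat_unit k i : (i < k)%N -> Rat R k i \in unitmx.
Proof.
move=> ik; have : Rat R k i *m Rat (invmx R) k i = 1%:M.
  by rewrite -Rat_mul // mulmxV ?hecke_unit // Rat1.
by case/mulmx1_unit.
Qed.

Lemma Rat_invmx k i : (i < k)%N -> invmx (Rat R k i) = Rat (invmx R) k i.
Proof.
move=> ik; rewrite -[RHS](mulKmx (Rat_unit ik)) -Rat_mul // mulmxV ?hecke_unit //.
by rewrite Rat1 mulmx1.
Qed.

Lemma Rat_quad k i : (i < k)%N -> Rat R k i *m Rat R k i = 1%:M + lam *: Rat R k i.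
Proof.
move=> ik; rewrite -Rat_mul // hecke_quad (addrC 1%:M (lam *: R)) Rat_linear Rat1.
exact: addrC.
Qed.

Lemma Rat_far (X Y : tmx F n 2) k i j : (i.+1 < j < k)%N ->
  Rat X k i *m Rat Y k j = Rat Y k j *m Rat X k i.
Proof.
case/andP=> ij jk; have ik : (i < k)%N by apply: leq_ltn_trans jk; do 2!apply: ltnW.
rewrite !Rat_pos emb_comm //; [exact: Rat_inj|exact: Rat_inj|move=> a b].
have le1 m (c : 'I_2) : (m + c <= m.+1)%N by rewrite -[m.+1]addn1 leq_add2l -ltnS.
apply/eqP => /(congr1 val); rewrite /= !inordK.
- move=> e; have : (i + a < j + b)%N; last by rewrite e ltnn.
  by apply: leq_trans (leq_addr _ _); apply: leq_ltn_trans ij; apply: le1.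
- by rewrite ltnS; apply: leq_trans jk; apply: le1.
- by rewrite ltnS; apply: leq_trans ik; apply: le1.
Qed.

Hypothesis YB : yang_baxter R.

Lemma Rat_braid k i : (i.+1 < k)%N ->
  Rat R k i *m Rat R k i.+1 *m Rat R k i = Rat R k i.+1 *m Rat R k i *m Rat R k i.+1.
Proof.
move=> ik; have fI : injective (pos k i 3) by apply: pos_inj; rewrite addn3 !ltnS.
have e j : (j < 2)%N -> emb (pos k i 3) (Rat R 2 j) = Rat R k (i + j).
  by move=> j2; rewrite !Rat_pos emb_pos_comp ?addn2 ?addn3.
have := congr1 (emb (pos k i 3)) YB; rewrite !emb_mul // !e //.
by rewrite addn0 addn1.
Qed.

Lemma invmx_braid N (X Y : 'M[F]_N) : X \in unitmx -> Y \in unitmx ->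
  X *m Y *m X = Y *m X *m Y ->
  invmx X *m invmx Y *m invmx X = invmx Y *m invmx X *m invmx Y.
Proof.
move=> uX uY e; have e3 (A B : 'M[F]_N) : A \in unitmx -> B \in unitmx ->
    invmx A *m invmx B *m invmx A = invmx (A *m B *m A).
  move=> uA uB; have uAB : A *m B \in unitmx by rewrite unitmx_mul uA.
  have uABA : A *m B *m A \in unitmx by rewrite unitmx_mul uAB.
  by apply: (can_inj (mulKmx uABA)); rewrite mulmxV // !mulmxA !mulmxK // mulmxV.
by rewrite e3 // e e3.
Qed.

(** The form of the braid relation to which the partial trace against [Bmx] is
    applied: on one side both outer factors act beyond the traced space. *)
Lemma conj_braid N (X Y : 'M[F]_N) : X \in unitmx -> Y \in unitmx ->
  X *m Y *m X = Y *m X *m Y ->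
  X *m Y *m invmx X = invmx Y *m X *m Y.
Proof.
move=> uX uY e; apply: (canLR (mulmxK uX)); rewrite -!mulmxA (mulmxA X) e -!mulmxA.
by rewrite mulKmx.
Qed.

End HeckeRMatrix.

(** * Index identities of a skew-invertible R-matrix *)

Section Words.
Variable n : nat.
Implicit Types a b c : 'I_n.

Definition word2 a b : widx n 2 := [ffun x => tnth [tuple a; b] x].
Definition word3 a b c : widx n 3 := [ffun x => tnth [tuple a; b; c] x].

Lemma word2_eta (I : widx n 2) : word2 (I ord0) (I ord_max) = I.
Proof.
apply/ffunP => x; rewrite ffunE (tnth_nth (I ord0)).
by case: x => [[|[|//]] h] /=; congr (I _); apply: val_inj.
Qed.

Lemma word3_eta (I : widx n 3) : word3 (I ord0) (I (inord 1)) (I ord_max) = I.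
Proof.
apply/ffunP => x; rewrite ffunE (tnth_nth (I ord0)).
by case: x => [[|[|[|//]]] h] /=; congr (I _); apply: val_inj; rewrite /= ?inordK.
Qed.

Lemma eq_word2 a b c d : (word2 a b == word2 c d) = (a == c) && (b == d).
Proof.
apply/eqP/andP => [/ffunP e|[/eqP-> /eqP->]//].
have := e ord0; have := e ord_max; rewrite !ffunE !(tnth_nth a) /= => -> ->.
by rewrite !eqxx.
Qed.

Lemma big_word2 (T : nmodType) (G : widx n 2 -> T) : \sum_I G I = \sum_a \sum_b G (word2 a b).
Proof.
rewrite pair_bigA /= (reindex (fun p : 'I_n * 'I_n => word2 p.1 p.2)) //=.
exists (fun I => (I ord0, I ord_max)) => [[a b] _|I _] /=; last exact: word2_eta.
by rewrite !ffunE !(tnth_nth a).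
Qed.

Lemma big_word3 (T : nmodType) (G : widx n 3 -> T) :
  \sum_I G I = \sum_a \sum_b \sum_c G (word3 a b c).
Proof.
under [RHS]eq_bigr do rewrite pair_bigA /=.
rewrite pair_bigA /= (reindex (fun p : 'I_n * ('I_n * 'I_n) => word3 p.1 p.2.1 p.2.2)) //=.
exists (fun I => (I ord0, (I (inord 1), I ord_max))) => [[a [b c]] _|I _] /=; last exact: word3_eta.
by rewrite !ffunE !(tnth_nth a) /= inordK.
Qed.

Section Entries.
Variable F : fieldType.
Implicit Types X : tmx F n 2.

Lemma wrestr_word0 a b c : wrestr (pos 2 0 2) (word3 a b c) = word2 a b.
Proof.
by apply/ffunP => -[[|[|//]] h]; rewrite !ffunE /pos !(tnth_nth a) /= inordK.
Qed.

Lemma wrestr_word1 a b c : wrestr (pos 2 1 2) (word3 a b c) = word2 b c.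
Proof.
by apply/ffunP => -[[|[|//]] h]; rewrite !ffunE /pos !(tnth_nth a) /= inordK.
Qed.

Lemma ent_Rat0 X a b c a' b' c' :
  ent (Rat X 2 0) (word3 a b c) (word3 a' b' c') =
  ent X (word2 a b) (word2 a' b') * (c == c')%:R.
Proof.
rewrite Rat_pos ent_emb !wrestr_word0.
suff -> : agree_off (pos 2 0 2) (word3 a b c) (word3 a' b' c') = (c == c').
  by case: eqP; rewrite ?mulr1 ?mulr0.
apply/agree_offP/eqP => [/(_ ord_max)|-> x].
  rewrite !ffunE !(tnth_nth a) /=; apply; apply/codomP => -[[x h]] /(congr1 val).
  by move=> e; have := h; rewrite -[x]add0n -(inordK (ltnW h : (0 + x < 3)%N)) -e.
case: x => [[|[|[|//]]] h]; rewrite !ffunE !(tnth_nth a) //= => /codomP[].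
  by exists ord0; apply: val_inj; rewrite /= inordK.
by exists ord_max; apply: val_inj; rewrite /= inordK.
Qed.

Lemma ent_Rat1 X a b c a' b' c' :
  ent (Rat X 2 1) (word3 a b c) (word3 a' b' c') =
  ent X (word2 b c) (word2 b' c') * (a == a')%:R.
Proof.
rewrite Rat_pos ent_emb !wrestr_word1.
suff -> : agree_off (pos 2 1 2) (word3 a b c) (word3 a' b' c') = (a == a').
  by case: eqP; rewrite ?mulr1 ?mulr0.
apply/agree_offP/eqP => [/(_ ord0)|-> x].
  rewrite !ffunE !(tnth_nth a) /=; apply; apply/codomP => -[[x h]] /(congr1 val).
  by rewrite /= inordK.
case: x => [[|[|[|//]]] h]; rewrite !ffunE !(tnth_nth a) //= => /codomP[].
  by exists ord0; apply: val_inj; rewrite /= inordK.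
by exists ord_max; apply: val_inj; rewrite /= inordK.
Qed.

Lemma sum_delta (T : pzSemiRingType) (m : finType) (f : m -> T) x :
  \sum_y f y * (x == y)%:R = f x.
Proof.
rewrite (bigD1 x) //= eqxx mulr1 big1 ?addr0 // => y /negPf.
by rewrite eq_sym => ->; rewrite mulr0.
Qed.

Lemma ent_Rat0_mul X (M : tmx F n 3) a b c J :
  ent (Rat X 2 0 *m M) (word3 a b c) J =
  \sum_u \sum_v ent X (word2 a b) (word2 u v) * ent M (word3 u v c) J.
Proof.
rewrite ent_mul big_word3; apply: eq_bigr => u _; apply: eq_bigr => v _.
under eq_bigr do rewrite ent_Rat0 mulrAC.
by rewrite sum_delta.
Qed.

Lemma ent_Rat1_mul X (M : tmx F n 3) a b c J :
  ent (Rat X 2 1 *m M) (word3 a b c) J =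
  \sum_u \sum_v ent X (word2 b c) (word2 u v) * ent M (word3 a u v) J.
Proof.
rewrite ent_mul big_word3 (bigD1 a) //= [X in _ + X]big1 ?addr0.
  by apply: eq_bigr => u _; apply: eq_bigr => v _; rewrite ent_Rat1 eqxx mulr1.
move=> u ua; rewrite big1 // => v _; rewrite big1 // => w _.
by rewrite ent_Rat1 eq_sym (negPf ua) mulr0 mul0r.
Qed.

Lemma ptrace_mid (M : tmx F n 3) a b c d :
  ent (ptrace (inord 1) M) (word2 a b) (word2 c d) = \sum_x ent M (word3 a x b) (word3 c x d).
Proof.
rewrite ent_tmx_of; apply: eq_bigr => x _.
have e u v : widx_insert (inord 1) x (word2 u v) = word3 u x v.
  apply/ffunP => c'; rewrite !ffunE (tnth_nth u) /=.
  case: unliftP => [d' ->|->]; last by rewrite /= inordK.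
  rewrite ffunE (tnth_nth u) /= /bump inordK //.
  by case: d' => [[|[|//]] h].
by rewrite !e.
Qed.

Lemma ent_flip a b c d :
  ent (flip_mx F n) (word2 a b) (word2 c d) = ((a == d) && (b == c))%:R.
Proof. by rewrite ent_tmx_of !ffunE !(tnth_nth a). Qed.
End Entries.
End Words.

Section SkewInverse.
Variables (F : fieldType) (n : nat) (R S Psi : tmx F n 2).
Local Notation ent2 X a b c d := (ent X (word2 a b) (word2 c d)).
Hypothesis skew : skew_inverse R Psi.
Let B := Bmx Psi.

Lemma BmxE i j : B i j = \sum_x ent2 Psi x i x j.
Proof.
rewrite mxE ent_tmx_of; apply: eq_bigr => x _.
have e u : widx_insert ord_max x [ffun=> u] = word2 u x.
  apply/ffunP => c; rewrite !ffunE (tnth_nth u) /=.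
  case: unliftP => [d ->|-> //]; rewrite ffunE lift_max.
  by case: d => [[|//] h].
rewrite !e ent_emb ifT.
  by congr (ent _ _ _); apply/ffunP => -[[|[|//]] h]; rewrite !ffunE !(tnth_nth x).
apply/agree_offP => c; case/codomP; case: (unliftP ord0 c) => [d|] ->.
  by exists ord0; apply: val_inj; case: d => [[|//] h].
by exists ord_max.
Qed.

Lemma skewR i j l m :
  \sum_x \sum_v ent2 R i x j v * ent2 Psi v l x m = ((i == m) && (l == j))%:R.
Proof.
rewrite -(@ent_flip n F i l j m) -skew.1 ptrace_mid; apply: eq_bigr => x _.
rewrite ent_Rat0_mul exchange_big; apply: eq_bigr => v _ /=.
under eq_bigr do rewrite ent_Rat1 mulrA eq_sym.
by rewrite sum_delta.
Qed.

Lemma skewL i j l m :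
  \sum_x \sum_v ent2 Psi i x j v * ent2 R v l x m = ((i == m) && (l == j))%:R.
Proof.
rewrite -(@ent_flip n F i l j m) -skew.2 ptrace_mid; apply: eq_bigr => x _.
rewrite (_ : at2 _ _ _ = Rat Psi 2 0) // ent_Rat0_mul exchange_big; apply: eq_bigr => v _ /=.
under eq_bigr do rewrite ent_Rat1 mulrA eq_sym.
by rewrite sum_delta.
Qed.

(** X cut into blocks by the indices of its second factor, so that partial traces
    over the first factor become traces of products of square matrices. *)
Definition block (X : tmx F n 2) x y : 'M[F]_n := \matrix_(a, b) ent2 X a x b y.

Lemma mxtrace_mul (M N : 'M[F]_n) : \tr (M *m N) = \sum_b \sum_a M b a * N a b.
Proof. by apply: eq_bigr => b _; rewrite mxE. Qed.

(** Tr_1(B_1 R_12) = 1: trace the first factor in Tr_2(Psi_12 R_23) = P_13. *)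
Lemma tr_block_R x y : \tr (B *m block R x y) = (x == y)%:R.
Proof.
rewrite mxtrace_mul; under eq_bigr do under eq_bigr do rewrite BmxE mxE mulr_suml.
under eq_bigr do rewrite exchange_big.
rewrite exchange_big /= (eq_bigr (fun d => (x == d)%:R * (y == d)%:R)); last first.
  by move=> d _; rewrite skewL -natrM mulnb andbC (eq_sym d).
by rewrite sum_delta.
Qed.

(** Contracting with Psi recovers a linear function of the blocks from its values
    on the blocks of R_23; the right-hand side then closes up to a trace of Psi,
    which is B. *)
Lemma skew_contract (phi : 'I_n -> 'I_n -> F) (c : F) :
  (forall k z, \sum_u \sum_v ent2 R u k v z * phi u v = c * (k == z)%:R) ->
  forall m l, phi m l = c * B l m.
Proof.
move=> h m l.
transitivity (\sum_u \sum_v ((u == m) && (l == v))%:R * phi u v).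
  rewrite (bigD1 m) //= [X in _ + X]big1 ?addr0; last first.
    by move=> u /negPf um; rewrite big1 // => v _; rewrite um mul0r.
  under eq_bigr do rewrite eqxx /= mulrC.
  by rewrite sum_delta.
under eq_bigr do under eq_bigr do rewrite -skewR mulr_suml.
under eq_bigr do rewrite exchange_big.
rewrite exchange_big /= BmxE mulr_sumr; apply: eq_bigr => k _.
under eq_bigr do under eq_bigr do rewrite mulr_suml.
under eq_bigr do rewrite exchange_big.
rewrite exchange_big /= -[RHS](sum_delta (fun z => c * ent2 Psi z l k m)).
apply: eq_bigr => z _; rewrite mulrAC -h mulr_suml; apply: eq_bigr => u _.
by rewrite mulr_suml; apply: eq_bigr => v _; rewrite mulrAC.
Qed.

Hypothesis SR : S *m R = 1%:M.
Hypothesis RS : R *m S = 1%:M.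
Hypothesis braidRS : Rat R 2 0 *m Rat R 2 1 *m Rat S 2 0 = Rat S 2 1 *m Rat R 2 0 *m Rat R 2 1.
Hypothesis braidSR : Rat S 2 0 *m Rat R 2 1 *m Rat R 2 0 = Rat R 2 1 *m Rat R 2 0 *m Rat S 2 1.

Lemma ent_conj (X Y Z : tmx F n 2) a j k c y z :
  ent (Rat X 2 0 *m Rat Y 2 1 *m Rat Z 2 0) (word3 a j k) (word3 c y z) =
  \sum_u \sum_v ent2 Y u k v z * (block X j u *m block Z v y) a c.
Proof.
rewrite -mulmxA ent_Rat0_mul exchange_big; apply: eq_bigr => u _ /=.
under [RHS]eq_bigr do rewrite mxE mulr_sumr.
rewrite [RHS]exchange_big; apply: eq_bigr => b _ /=.
rewrite ent_Rat1_mul mulr_sumr; apply: eq_bigr => v _.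
under eq_bigr do rewrite ent_Rat0 mulrA eq_sym.
by rewrite sum_delta !mxE mulrCA.
Qed.

Lemma ent_conj' (X Y Z : tmx F n 2) a j k c y z :
  ent (Rat X 2 1 *m Rat Y 2 0 *m Rat Z 2 1) (word3 a j k) (word3 c y z) =
  \sum_u \sum_v \sum_w ent2 X j k u w * ent2 Z v w y z * block Y u v a c.
Proof.
rewrite -mulmxA ent_Rat1_mul; apply: eq_bigr => u _.
rewrite /= [RHS]exchange_big; apply: eq_bigr => w _ /=.
rewrite ent_Rat0_mul exchange_big mulr_sumr; apply: eq_bigr => v _ /=.
under eq_bigr do rewrite ent_Rat1 mulrA eq_sym.
by rewrite sum_delta !mxE -mulrA; congr (_ * _); rewrite mulrC.
Qed.

(** Apply Tr_1(B_1 .) to X_12 R_23 Z_12 = X'_23 R_12 Z'_23. On the right the trace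
    sees only R_12 and gives 1 by [tr_block_R], leaving X' Z' = 1; on the left
    R_23 is then replaced by an arbitrary matrix through [skew_contract]. *)
Lemma tr_block_braid (X Z X' Z' : tmx F n 2) j y m l :
  X' *m Z' = 1%:M ->
  Rat X 2 0 *m Rat R 2 1 *m Rat Z 2 0 = Rat X' 2 1 *m Rat R 2 0 *m Rat Z' 2 1 ->
  \tr (B *m (block X j m *m block Z l y)) = (j == y)%:R * B l m.
Proof.
move=> XZ e; pose phi u v := \tr (B *m (block X j u *m block Z v y)).
apply: (skew_contract (phi := phi)) => {m l} k z.
pose M := \matrix_(a, c) ent (Rat X 2 0 *m Rat R 2 1 *m Rat Z 2 0) (word3 a j k) (word3 c y z).
transitivity (\tr (B *m M)).
  rewrite (_ : M = \sum_u \sum_v ent2 R u k v z *: (block X j u *m block Z v y)).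
    rewrite mulmx_sumr raddf_sum; apply: eq_bigr => u _.
    rewrite mulmx_sumr raddf_sum; apply: eq_bigr => v _.
    by rewrite -scalemxAr /= mxtraceZ.
  apply/matrixP => a c; rewrite mxE ent_conj summxE; apply: eq_bigr => u _.
  by rewrite summxE; apply: eq_bigr => v _; rewrite [RHS]mxE.
rewrite (_ : M = \sum_u \sum_v \sum_w (ent2 X' j k u w * ent2 Z' v w y z) *: block R u v).
  rewrite mulmx_sumr raddf_sum.
  under eq_bigr => u _.
    rewrite mulmx_sumr raddf_sum.
    under eq_bigr => v _.
      rewrite mulmx_sumr raddf_sum.
      under eq_bigr => w _ do rewrite -scalemxAr /= mxtraceZ tr_block_R.
      rewrite -mulr_suml; over.
    rewrite sum_delta; over.
  have := congr1 (fun M : tmx F n 2 => ent2 M j k y z) XZ.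
  rewrite /= ent_mul big_word2 ent_scalar eq_word2 => ->.
  by rewrite -mulnb natrM.
apply/matrixP => a c; rewrite mxE e ent_conj' summxE; apply: eq_bigr => u _.
rewrite summxE; apply: eq_bigr => v _; rewrite summxE; apply: eq_bigr => w _.
by rewrite [RHS]mxE.
Qed.

(** Tr_1(B_1 R_12 R_13^-1) = B_3 P_23, in blocks. *)
Lemma tr_block_RS j y m l : \tr (B *m (block R j m *m block S l y)) = (j == y)%:R * B l m.
Proof. exact: tr_block_braid SR braidRS. Qed.

Lemma tr_block_SR j y m l : \tr (B *m (block S j m *m block R l y)) = (j == y)%:R * B l m.
Proof. exact: tr_block_braid RS braidSR. Qed.

Lemma contract_R (G : 'I_n -> 'I_n -> F) e f :
  \sum_j \sum_m (\sum_a \sum_b ent2 R a j b m * G a b) * ent2 Psi m e j f = G f e.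
Proof.
transitivity (\sum_a \sum_b ((a == f) && (e == b))%:R * G a b).
  under eq_bigr do under eq_bigr do rewrite mulr_suml.
  under eq_bigr do rewrite exchange_big.
  rewrite exchange_big; apply: eq_bigr => a _ /=.
  under eq_bigr do under eq_bigr do rewrite mulr_suml.
  under eq_bigr do rewrite exchange_big.
  rewrite exchange_big; apply: eq_bigr => b _ /=.
  rewrite -skewR mulr_suml; apply: eq_bigr => j _.
  by rewrite mulr_suml; apply: eq_bigr => m _; rewrite mulrAC.
rewrite (bigD1 f) //= [X in _ + X]big1 ?addr0; last first.
  by move=> a /negPf af; rewrite big1 // => b _; rewrite af mul0r.
under eq_bigr do rewrite eqxx /= mulrC.
by rewrite sum_delta.
Qed.

(** R_12^-1 B_1 = B_2 Psi_21, obtained by removing R from [tr_block_RS]. *)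
Lemma B_left e l f y :
  \sum_c ent2 S e l c y * B c f = \sum_m B l m * ent2 Psi m e y f.
Proof.
rewrite -(contract_R (fun a b => \sum_c ent2 S b l c y * B c a)).
transitivity (\sum_j \sum_m (j == y)%:R * B l m * ent2 Psi m e j f).
  apply: eq_bigr => j _; apply: eq_bigr => m _; rewrite -tr_block_RS; congr (_ * _).
  rewrite mxtrace_mulC -mulmxA mxtrace_mul.
  apply: eq_bigr => a _; apply: eq_bigr => b _ /=; rewrite !mxE; congr (_ * _).
  by apply: eq_bigr => c _; rewrite [block _ _ _ _ _]mxE.
rewrite exchange_big; apply: eq_bigr => m _ /=.
under eq_bigr do rewrite -mulrA mulrC (eq_sym _ y).
by rewrite sum_delta.
Qed.

(** B_1 R_12^-1 = Psi_21 B_2, obtained by removing R from [tr_block_SR]. *)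
Lemma B_right e j f m :
  \sum_a B e a * ent2 S a j f m = \sum_l B l m * ent2 Psi j e l f.
Proof.
rewrite -(contract_R (fun b c => \sum_a B c a * ent2 S a j b m)).
transitivity (\sum_l \sum_y (j == y)%:R * B l m * ent2 Psi y e l f).
  apply: eq_bigr => l _; apply: eq_bigr => y _; rewrite -tr_block_SR; congr (_ * _).
  rewrite mulmxA mxtrace_mulC mxtrace_mul.
  apply: eq_bigr => a _; apply: eq_bigr => b _ /=; rewrite !mxE; congr (_ * _).
  by apply: eq_bigr => c _; rewrite [block _ _ _ _ _]mxE.
apply: eq_bigr => l _ /=.
under eq_bigr do rewrite -mulrA mulrC.
by rewrite sum_delta.
Qed.

(** The matrix B_1 B_2. *)
Definition Bmx2 : tmx F n 2 :=
  tmx_of (fun I J => B (I ord0) (J ord0) * B (I ord_max) (J ord_max)).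

Lemma ent_Bmx2 a b c d : ent2 Bmx2 a b c d = B a c * B b d.
Proof. by rewrite ent_tmx_of !ffunE !(tnth_nth a). Qed.

(** Both sides equal B_2 Psi_21 B_2, by [B_left] and [B_right]. *)
Lemma Bmx2_comm_S : S *m Bmx2 = Bmx2 *m S.
Proof.
apply: tmxP => I J; rewrite -(word2_eta I) -(word2_eta J).
move: (I ord0) (I ord_max) (J ord0) (J ord_max) => e l f y.
rewrite !ent_mul !big_word2 exchange_big.
transitivity (\sum_x (\sum_c ent2 S e l c x * B c f) * B x y).
  apply: eq_bigr => x _; rewrite mulr_suml; apply: eq_bigr => c _.
  by rewrite ent_Bmx2 mulrA.
under eq_bigr do rewrite B_left mulr_suml.
rewrite exchange_big [RHS]exchange_big; apply: eq_bigr => m _ /=.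
transitivity (B l m * \sum_a B e a * ent2 S a m f y).
  rewrite B_right mulr_sumr; apply: eq_bigr => x _.
  by rewrite -mulrA; congr (_ * _); rewrite mulrC.
rewrite mulr_sumr; apply: eq_bigr => a _; rewrite ent_Bmx2 mulrA.
by congr (_ * _); rewrite mulrC.
Qed.

Lemma Bmx2_comm_R : R *m Bmx2 = Bmx2 *m R.
Proof.
rewrite -[LHS]mulmx1 -SR mulmxA -(mulmxA R) -Bmx2_comm_S.
by rewrite (mulmxA R) RS mul1mx.
Qed.
End SkewInverse.

(** * The reflection equation on tensor powers *)

Section AuxiliaryMatrices.
Variables (A : pzRingType) (n : nat).
Implicit Types (l : 'I_n -> 'I_n -> A).

(** L_1, that is L in the first of the two auxiliary factors. *)
Definition aux1 l : tmx A n 2 := at1 ord0 (\matrix_(i, j) l i j).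

Lemma ent_aux1 l i x j y :
  ent (aux1 l) (word2 i x) (word2 j y) = if x == y then l i j else 0.
Proof.
rewrite ent_emb ent_tmx_of mxE !ffunE !(tnth_nth i) /=.
congr (if _ then _ else _); apply/agree_offP/eqP => [/(_ ord_max)|-> c].
  by rewrite !ffunE !(tnth_nth i); apply; apply/codomP => -[].
case: (unliftP ord0 c) => [d|] ->; last by case/codomP; exists ord0.
by rewrite !ffunE !(tnth_nth i) /= ord1.
Qed.

Lemma ent_aux1_mul l (M : tmx A n 2) i x J :
  ent (aux1 l *m M) (word2 i x) J = \sum_a l i a * ent M (word2 a x) J.
Proof.
rewrite ent_mul big_word2; apply: eq_bigr => a _.
rewrite (bigD1 x) //= ent_aux1 eqxx big1 ?addr0 // => y /negPf yx.
by rewrite ent_aux1 eq_sym yx mul0r.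
Qed.

Lemma ent_mul_aux1 l (M : tmx A n 2) I j y :
  ent (M *m aux1 l) I (word2 j y) = \sum_b ent M I (word2 b y) * l b j.
Proof.
rewrite ent_mul big_word2; apply: eq_bigr => b _.
rewrite (bigD1 y) //= ent_aux1 eqxx big1 ?addr0 // => x /negPf xy.
by rewrite ent_aux1 xy mulr0.
Qed.

Lemma ent_scalar_mul c (M : tmx A n 2) I J : ent (c%:M *m M) I J = c * ent M I J.
Proof. by rewrite mul_scalar_mx entZ. Qed.

Lemma ent_mul_scalar c (M : tmx A n 2) I J : ent (M *m c%:M) I J = ent M I J * c.
Proof.
rewrite ent_mul (bigD1 J) //= ent_scalar eqxx mulr1n big1 ?addr0 // => K /negPf KJ.
by rewrite ent_scalar KJ mulr0.
Qed.

(** The second auxiliary index only runs through M; this is what turns products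
    of two generators into contractions against the blocks of R. *)
Lemma ent_aux1_sandwich l l' c (M : tmx A n 2) i x j y :
  ent (aux1 l *m c%:M *m M *m aux1 l') (word2 i x) (word2 j y) =
  \sum_a \sum_b l i a * c * ent M (word2 a x) (word2 b y) * l' b j.
Proof.
rewrite -!mulmxA ent_aux1_mul; apply: eq_bigr => a _.
rewrite ent_scalar_mul ent_mul_aux1 !mulr_sumr.
by apply: eq_bigr => b _; rewrite !mulrA.
Qed.

Lemma aux1_scalar l c c' : c%:M *m aux1 l *m c'%:M = aux1 (fun i j => c * l i j * c').
Proof.
apply: tmxP => I J; rewrite -(word2_eta I) -(word2_eta J).
rewrite ent_mul_scalar ent_scalar_mul !ent_aux1.
by case: eqP; rewrite ?mulr0 ?mul0r.
Qed.

Lemma aux1_sum (s : seq nat) (l : nat -> 'I_n -> 'I_n -> A) :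
  \sum_(i <- s) aux1 (l i) = aux1 (fun a b => \sum_(i <- s) l i a b).
Proof.
elim: s => [|i s IH]; last rewrite big_cons IH.
  rewrite big_nil; apply: tmxP => I J; rewrite -(word2_eta I) -(word2_eta J).
  by rewrite ent_aux1 ent0 big_nil if_same.
apply: tmxP => I J; rewrite -(word2_eta I) -(word2_eta J) entD !ent_aux1.
by case: eqP; rewrite ?addr0 ?big_cons.
Qed.

Lemma scalar_mx_comm c (M : tmx A n 2) :
  (forall I J, c * ent M I J = ent M I J * c) -> c%:M *m M = M *m c%:M.
Proof. by move=> h; apply: tmxP => I J; rewrite ent_scalar_mul ent_mul_scalar. Qed.

End AuxiliaryMatrices.

Lemma ent_sum (T : nmodType) n k (J : Type) (r : seq J) (X : J -> tmx T n k) I K :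
  ent (\sum_(j <- r) X j) I K = \sum_(j <- r) ent (X j) I K.
Proof. by rewrite /ent summxE. Qed.

Section OneFactor.
Variables (F : fieldType) (n k : nat).

Lemma big_word1 (T : nmodType) (G : widx n 1 -> T) : \sum_I G I = \sum_a G [ffun=> a].
Proof.
rewrite (reindex (fun a : 'I_n => [ffun=> a] : widx n 1)) //.
exists (fun I : widx n 1 => I ord0) => [a _|I _]; first by rewrite ffunE.
by apply/ffunP => x; rewrite ffunE [x]ord1.
Qed.

Lemma at1_mul (a : 'I_k) (X Y : 'M[F]_n) : at1 a (X *m Y) = at1 a X *m at1 a Y.
Proof.
rewrite /at1 -emb_mul; last by move=> b c _; rewrite !ord1.
congr emb; apply: tmxP => I J; rewrite ent_mul big_word1 ent_tmx_of mxE.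
by apply: eq_bigr => x _; rewrite !ent_tmx_of !ffunE.
Qed.

Lemma at1Z (a : 'I_k) c (X : 'M[F]_n) : at1 a (c *: X) = c *: at1 a X.
Proof.
apply: tmxP => I J; rewrite entZ !ent_emb; case: ifP => _; last by rewrite mulr0.
by rewrite !ent_tmx_of mxE.
Qed.

Lemma ent_at1_0 (X : 'M[F]_n) i x j y :
  ent (at1 ord0 X) (word2 i x) (word2 j y) = X i j * (x == y)%:R.
Proof.
have := ent_aux1 (fun i j => X i j) i x j y; rewrite /aux1.
have -> : \matrix_(i, j) X i j = X by apply/matrixP => a b; rewrite mxE.
by move=> ->; case: eqP; rewrite ?mulr1 ?mulr0.
Qed.
End OneFactor.

Lemma at1_first (F : fieldType) n k (X : 'M[F]_n) : (0 < k)%N ->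
  at1 (ord0 : 'I_k.+1) X = Rat (at1 ord0 X : tmx F n 2) k 0.
Proof.
move=> k0; rewrite Rat_pos /at1 emb_comp; last exact: Rat_inj.
by apply: eq_emb => a /=; apply: val_inj; rewrite /= inordK.
Qed.

Lemma map_mx_refl (A A' : pzRingType) (phi : {rmorphism A -> A'}) m (T L : 'M[A]_m) :
  map_mx phi ((T *m L *m T *m L - L *m T *m L *m T) - (T *m L - L *m T)) =
  let T' := map_mx phi T in let L' := map_mx phi L in
  (T' *m L' *m T' *m L' - L' *m T' *m L' *m T') - (T' *m L' - L' *m T').
Proof. by rewrite !map_mxB !map_mxM. Qed.

Section ReflectionModule.
Variables (F : fieldType) (n k : nat) (q : F) (R Psi : tmx F n 2).
Hypotheses (q0 : q != 0) (YB : yang_baxter R) (hecke : hecke_condition q R).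
Hypothesis skew : skew_inverse R Psi.

Local Notation N := #|widx n k.+1|.
Let lam := q - q^-1.
Let B := Bmx Psi.
Let S := invmx R.
Let p i j : tmx F n k.+1 := at1 ord0 (pit Psi i j).

(** The operator of a generator at position s of the ladder, in the transposed
    form in which [rhot] is written. *)
Definition rho_term s i j : tmx F n k.+1 := chain_down R k s *m p i j *m chain_up R k s.

Lemma rho_term0 i j : rho_term 0 i j = p i j.
Proof. by rewrite /rho_term /chain_down /chain_up /= !big_nil mul1mx mulmx1. Qed.

Lemma rho_termS s i j :
  rho_term s.+1 i j = invmx (Rat R k s) *m rho_term s i j *m invmx (Rat R k s).
Proof.
rewrite /rho_term /chain_down /chain_up -[s.+1]addn1 iotaD rev_cat big_cat /= big_cat /=.
by rewrite !big_seq1 add0n -!mulmxA.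
Qed.

Lemma rhotE i j : rhot R Psi k i j = \sum_(s < k.+1) rho_term s i j.
Proof.
rewrite /rhot -(big_mkord xpredT (fun s => rho_term s i j)) [RHS]big_nat_recl // rho_term0.
congr (_ + _); rewrite big_add1.
by apply: eq_big_nat.
Qed.

Let g i := Rat R k i.
Let Q i := invmx (Rat R k i).

Let uR : R \in unitmx := hecke_unit q0 hecke.
Let ug i : (i < k)%N -> g i \in unitmx.
Proof. exact: Rat_unit q0 hecke _ _. Qed.

Lemma Rat_inv_braid i : (i.+1 < k)%N -> Q i *m Q i.+1 *m Q i = Q i.+1 *m Q i *m Q i.+1.
Proof. by move=> ik; apply: invmx_braid; rewrite ?ug // ?Rat_braid // ltnW. Qed.

Lemma Rat_inv_far i j : (i.+1 < j < k)%N -> Q i *m Q j = Q j *m Q i.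
Proof.
move=> h; have /andP[ij jk] := h.
have ik : (i < k)%N by apply: leq_ltn_trans jk; do 2!apply: ltnW.
by rewrite /Q (Rat_invmx q0 hecke ik) (Rat_invmx q0 hecke jk) (Rat_far _ _ h).
Qed.

Lemma Rat_inv_quad m : (m < k)%N -> Q m *m Q m = 1%:M - lam *: Q m.
Proof.
move=> mk; rewrite /Q (Rat_invmx q0 hecke) // -Rat_mul // (hecke_quad_inv q0 hecke).
by rewrite [_ - _]addrC -scaleNr Rat_linear Rat1 addrC scaleNr.
Qed.

Lemma Rat_inv_add m : (m < k)%N -> g m = Q m + lam%:M.
Proof.
move=> mk; rewrite /Q (Rat_invmx q0 hecke) // (hecke_invmx q0 hecke).
rewrite (_ : R - lam%:M = (- lam) *: 1%:M + R); last by rewrite scaleNr scalemx1 addrC.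
by rewrite Rat_linear Rat1 scaleNr scalemx1 [- _ + _]addrC subrK.
Qed.

Lemma Rat_inv_comm_first m i j : (0 < m < k)%N -> Q m *m p i j = p i j *m Q m.
Proof.
case/andP=> m0 mk; rewrite /Q (Rat_invmx q0 hecke) // Rat_pos /p /at1.
apply: emb_comm; [exact: Rat_inj|by move=> a b _; rewrite !ord1|move=> a b].
apply/eqP => /(congr1 val); rewrite /= inordK.
  by move=> e; move: m0; rewrite lt0n -leqn0 -e leq_addr.
by rewrite ltnS; apply: leq_trans mk; rewrite -[m.+1]addn1 leq_add2l -ltnS.
Qed.

(** Inverting the Hecke relation gives g_m = Q_m + lambda, so that commuting with
    the inverse Q_m is enough, and the ladder runs on the Q's. *)
Lemma rhot_comm m i j : (m < k)%N -> g m *m rhot R Psi k i j = rhot R Psi k i j *m g m.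
Proof.
move=> mk; rewrite rhotE; set X := \sum_(s < _) _.
suff QX : Q m *m X = X *m Q m by rewrite (Rat_inv_add mk) mulmxDl QX mulmxDr scalar_mxC.
apply: (@ladder_sum_comm 'M[F]_N k Q (fun s => rho_term s i j) _ _ _ _ lam%:M) => //.
- exact: Rat_inv_braid.
- exact: Rat_inv_far.
- by move=> s sk; rewrite rho_termS.
- by move=> m' hm; rewrite rho_term0; apply: Rat_inv_comm_first.
- by move=> m' _; apply/esym/scalar_mxC.
- by move=> s _; apply/esym/scalar_mxC.
- by move=> m' hm; rewrite [LHS]Rat_inv_quad // -[lam%:M * _]/(_ *m _) mul_scalar_mx.
Qed.

Let SR : S *m R = 1%:M.
Proof. exact: mulVmx. Qed.
Let RS : R *m S = 1%:M.
Proof. exact: mulmxV. Qed.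

Lemma pitE i j m s : pit Psi i j m s = B m j * (s == i)%:R.
Proof. by rewrite mxE. Qed.

Lemma pit_mul b j i a : pit Psi b j *m pit Psi i a = B b a *: pit Psi i j.
Proof.
apply/matrixP => m s; rewrite mxE [RHS]mxE (bigD1 b) //= big1 ?addr0 => [|t /negPf tb].
  by rewrite !pitE eqxx mulr1 mulrCA.
by rewrite !pitE tb mulr0 mul0r.
Qed.

Lemma fundamental_trace i x j y :
  \sum_a \sum_b ent R (word2 a x) (word2 b y) *: (p b j *m p i a) =
  (x == y)%:R *: p i j.
Proof.
rewrite -(tr_block_R skew) mxtrace_mul exchange_big scaler_suml; apply: eq_bigr => b _.
rewrite scaler_suml; apply: eq_bigr => a _.
by rewrite -at1_mul pit_mul at1Z scalerA [block _ _ _ _ _]mxE mulrC.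
Qed.

(** The operator e_I B^J of rank one on two quantum factors, where B^J is the
    functional with coordinates B_1 B_2 in column J. Since auxiliary
    indices label quantum vectors and functionals, R may act through either. *)
Definition cup (I J : widx n 2) : tmx F n 2 :=
  tmx_of (fun M M' => ent (Bmx2 Psi) M J * (M' == I)%:R).

Let braid20 : Rat R 2 0 *m Rat R 2 1 *m Rat R 2 0 = Rat R 2 1 *m Rat R 2 0 *m Rat R 2 1.
Proof. exact: YB. Qed.

Let braidRS : Rat R 2 0 *m Rat R 2 1 *m Rat S 2 0 = Rat S 2 1 *m Rat R 2 0 *m Rat R 2 1.
Proof.
by rewrite -!(Rat_invmx q0 hecke) //; apply: conj_braid => //; apply: (Rat_unit q0 hecke).
Qed.

Let braidSR : Rat S 2 0 *m Rat R 2 1 *m Rat R 2 0 = Rat R 2 1 *m Rat R 2 0 *m Rat S 2 1.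
Proof.
by rewrite -!(Rat_invmx q0 hecke) //; apply/esym/conj_braid => //; apply: (Rat_unit q0 hecke).
Qed.

Let pp i j : tmx F n 2 := at1 ord0 (pit Psi i j).

(** The two rank-one factors close the first quantum space, leaving the partial
    trace of [tr_block_RS] on the second one. *)
Lemma cup_fundamental i x j y :
  \sum_a \sum_b ent R (word2 a x) (word2 b y) *: (pp b j *m S *m pp i a) =
  cup (word2 i x) (word2 j y).
Proof.
have entpp u v m d m' d' : ent (pp u v) (word2 m d) (word2 m' d') =
    B m v * (m' == u)%:R * (d == d')%:R by rewrite ent_at1_0 pitE.
apply: tmxP => I J; rewrite -(word2_eta I) -(word2_eta J).
move: (I ord0) (I ord_max) (J ord0) (J ord_max) => m d m' d'.
rewrite [RHS]ent_tmx_of ent_Bmx2 eq_word2.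
have e a b : ent (pp b j *m S *m pp i a) (word2 m d) (word2 m' d') =
   (B m j * (m' == i)%:R) * \sum_c ent S (word2 b d) (word2 c d') * B c a.
  rewrite -mulmxA ent_mul big_word2 (bigD1 b) //= [X in _ + X]big1 ?addr0; last first.
    by move=> u /negPf ub; rewrite big1 // => v _; rewrite entpp ub mulr0 !mul0r.
  rewrite (bigD1 d) //= [X in _ + X]big1 ?addr0; last first.
    by move=> v /negPf vd; rewrite entpp eq_sym vd mulr0 !mul0r.
  rewrite entpp !eqxx !mulr1 ent_mul big_word2 -mulrA; congr (_ * _).
  rewrite mulr_sumr; apply: eq_bigr => c _.
  under eq_bigr => v _ do rewrite entpp mulrA (eq_sym v).
  by rewrite sum_delta mulrA mulrC.
transitivity ((B m j * (m' == i)%:R) *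
   \tr (B *m (block R x y *m block S d d'))).
  rewrite mxtrace_mulC -mulmxA mxtrace_mul mulr_sumr ent_sum; apply: eq_bigr => a _.
  rewrite mulr_sumr ent_sum; apply: eq_bigr => b _; rewrite entZ e mulrCA; congr (_ * _).
  rewrite !mxE; congr (_ * _); apply: eq_bigr => c _; by rewrite [block _ _ _ _ _]mxE.
rewrite (tr_block_RS skew SR braidRS) -mulnb natrM (eq_sym x) [_%:R * B d y]mulrC.
by rewrite mulrACA.
Qed.

Lemma cup_R I J : \sum_K ent R I K *: cup K J = cup I J *m R.
Proof.
apply: tmxP => M M'; rewrite ent_mul ent_sum.
transitivity (ent (Bmx2 Psi) M J * ent R I M').
  under eq_bigr do rewrite entZ ent_tmx_of mulrCA mulrA.
  by rewrite sum_delta.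
under eq_bigr => K _ do rewrite ent_tmx_of mulrAC (eq_sym K).
by rewrite sum_delta.
Qed.

Lemma R_cup I J : \sum_K ent R K J *: cup I K = R *m cup I J.
Proof.
apply: tmxP => M M'; rewrite ent_mul ent_sum.
transitivity (ent (Bmx2 Psi *m R) M J * (M' == I)%:R).
  rewrite ent_mul mulr_suml; apply: eq_bigr => K _.
  by rewrite entZ ent_tmx_of mulrCA mulrA.
rewrite -(Bmx2_comm_R skew SR RS braidRS braidSR) ent_mul mulr_suml.
by apply: eq_bigr => K _; rewrite [ent (cup _ _) _ _]ent_tmx_of mulrA.
Qed.

(* Matrices act on row vectors, which reverses products; the transposes below
   restore the order of the algebra. *)
Let A := 'M[F]_N.
Let auxR : tmx A n 2 := map_mx (fun c : F => c%:M : A) R.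
Let auxQ s : tmx A n 2 := (((Q s)^T : A)%:M).
Let auxlam : tmx A n 2 := ((lam%:M : A)%:M).
Let auxL s : tmx A n 2 := aux1 (fun i j => (rho_term s i j)^T : A).

Let scalarA_comm (c : F) (X : A) : (c%:M : A) * X = X * c%:M.
Proof. exact/esym/scalar_mxC. Qed.

Let ent_auxR I J : ent auxR I J = (ent R I J)%:M.
Proof. by rewrite /ent mxE. Qed.

Let auxlam_comm (M : tmx A n 2) : auxlam *m M = M *m auxlam.
Proof. by apply: scalar_mx_comm => I J; apply: scalarA_comm. Qed.

Let auxR_comm (X : A) : auxR *m X%:M = X%:M *m auxR.
Proof. by apply/esym/scalar_mx_comm => I J; rewrite ent_auxR scalarA_comm. Qed.

(** Each of the two quadratic terms is already equal to a linear one, because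
    L T L = L by [fundamental_trace]. *)
Lemma fundamental_refl :
  refl_bracket auxR (auxL 0%N) (auxL 0%N) = auxR *m auxL 0%N - auxL 0%N *m auxR.
Proof.
suff e : auxL 0%N *m auxR *m auxL 0%N = auxL 0%N.
  rewrite /refl_bracket -![_ * _]/(_ *m _).
  by rewrite -[X in X - _]mulmxA -[X in X - _]mulmxA (mulmxA (auxL 0)) e.
apply: tmxP => I J; rewrite -(word2_eta I) -(word2_eta J).
move: (I ord0) (I ord_max) (J ord0) (J ord_max) => i x j y.
rewrite -{1}[auxL 0]mulmx1 ent_aux1_sandwich ent_aux1.
transitivity ((\sum_a \sum_b ent R (word2 a x) (word2 b y) *: (p b j *m p i a))^T : A).
  rewrite linear_sum; apply: eq_bigr => a _; rewrite linear_sum; apply: eq_bigr => b _.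
  rewrite mulr1 ent_auxR -scalarA_comm !rho_term0 linearZ /= trmx_mul.
  by rewrite -mulrA -[_ * (_ * _)]/(_ *m (_ *m _)) mul_scalar_mx.
rewrite fundamental_trace rho_term0; case: eqP => _; first by rewrite scale1r.
by rewrite scale0r trmx0.
Qed.

Lemma ent_aux_cup I J : (0 < k)%N ->
  ent (auxL 0%N *m auxQ 0%N *m auxR *m auxL 0%N) I J = (Rat (cup I J) k 0)^T.
Proof.
move=> k0; rewrite -(word2_eta I) -(word2_eta J).
move: (I ord0) (I ord_max) (J ord0) (J ord_max) => i x j y.
rewrite ent_aux1_sandwich -cup_fundamental Rat_sum linear_sum.
apply: eq_bigr => a _; rewrite Rat_sum linear_sum; apply: eq_bigr => b _ /=.
rewrite ent_auxR !rho_term0 /p !(at1_first _ k0) /Q (Rat_invmx q0 hecke k0).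
rewrite -scalarA_comm -mulrA -![_ * _]/(_ *m _) mul_scalar_mx.
by rewrite -!trmx_mul -!Rat_mul // mulmxA RatZ linearZ.
Qed.

Lemma aux_cup_R : (0 < k)%N ->
  let Z := auxL 0%N *m auxQ 0%N *m auxR *m auxL 0%N in
  auxR *m Z = (auxQ 0%N + auxlam) *m Z /\ Z *m auxR = Z *m (auxQ 0%N + auxlam).
Proof.
move=> k0 Z.
have -> : auxQ 0%N + auxlam = ((g 0)^T : A)%:M.
  by rewrite -raddfD /= (Rat_inv_add k0) linearD /= tr_scalar_mx.
split; apply: tmxP => I J; rewrite ent_mul.
  rewrite ent_scalar_mul ent_aux_cup // -[_ * _]/(_ *m _) -trmx_mul -Rat_mul // -cup_R.
  rewrite Rat_sum linear_sum; apply: eq_bigr => K _; rewrite ent_aux_cup // ent_auxR.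
  by rewrite -[_ * _]/(_ *m _) mul_scalar_mx RatZ linearZ.
rewrite ent_mul_scalar ent_aux_cup // -[_ * _]/(_ *m _) -trmx_mul -Rat_mul // -R_cup.
rewrite Rat_sum linear_sum; apply: eq_bigr => K _; rewrite ent_aux_cup // ent_auxR.
by rewrite -scalarA_comm -[_ * _]/(_ *m _) mul_scalar_mx RatZ linearZ.
Qed.

Lemma rhot_refl :
  let X := aux1 (fun i j => (rhot R Psi k i j)^T : A) in
  refl_bracket auxR X X = auxR *m X - X *m auxR.
Proof.
have -> : aux1 (fun i j => (rhot R Psi k i j)^T : A) = \sum_(s < k.+1) auxL s.
  rewrite -(big_mkord xpredT) aux1_sum; congr at1; apply/matrixP => i j.
  by rewrite !mxE rhotE linear_sum big_mkord.
apply: (@reflection_ladder _ k auxR auxlam auxQ auxL).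
- move=> i ik; rewrite -![_ * _]/(_ *m _) /auxQ -!scalar_mxM -![_ * _]/(_ *m _) -!trmx_mul.
  by rewrite !mulmxA Rat_inv_braid.
- by move=> i j ij; rewrite -![_ * _]/(_ *m _) /auxQ -!scalar_mxM -![_ * _]/(_ *m _) -!trmx_mul (Rat_inv_far ij).
- move=> s sk; rewrite -![_ * _]/(_ *m _) aux1_scalar; congr at1; apply/matrixP => i j.
  by rewrite !mxE rho_termS -![_ * _]/(_ *m _) -!trmx_mul mulmxA.
- move=> m mk; rewrite -![_ * _]/(_ *m _); apply: scalar_mx_comm => I J.
  rewrite -(word2_eta I) -(word2_eta J) ent_aux1; case: eqP; rewrite ?mulr0 ?mul0r // => _.
  by rewrite -![_ * _]/(_ *m _) -!trmx_mul rho_term0 Rat_inv_comm_first.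
- exact: auxlam_comm.
- by move=> m _; apply: auxlam_comm.
- by move=> s _; apply: auxlam_comm.
- by move=> m _; apply: auxR_comm.
- move=> m mk; rewrite -![_ * _]/(_ *m _) /auxQ /auxlam -!scalar_mxM.
  rewrite -![_ * _]/(_ *m _) -trmx_mul (Rat_inv_quad mk) mul_scalar_mx linearB /= trmx1 linearZ.
  by rewrite raddfB.
- exact: fundamental_refl.
- by move=> k0; case: (aux_cup_R k0).
- by move=> k0; case: (aux_cup_R k0).
Qed.

Definition rho_gen (ij : 'I_n * 'I_n) : A := (rhot R Psi k ij.1 ij.2)^T.

Lemma rho_RE_relation I J : feval rho_gen (RE_relation R I J) = 0.
Proof.
pose phi : {rmorphism REfree F n -> A} := feval rho_gen.
have -> : feval rho_gen (RE_relation R I J) = map_mx phi (RE_relation R) I J by rewrite [RHS]mxE.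
have phiR : map_mx phi (RE_R12 R) = auxR.
  apply/matrixP => a b; rewrite mxE [RHS]mxE mxE.
  exact: (feval_scalar rho_gen).
have phiL : map_mx phi (RE_L1 F n) = aux1 (fun i j => (rhot R Psi k i j)^T : A).
  apply: tmxP => I' J'; rewrite -(word2_eta I') -(word2_eta J') ent_aux1.
  rewrite /ent mxE; have := ent_aux1 (fun i j => fgen F (i, j) : REfree F n).
  rewrite /ent /aux1 => ->; case: eqP => _; last exact: raddf0.
  exact: (feval_gen rho_gen).
rewrite /RE_relation map_mx_refl phiR phiL.
have := rhot_refl; rewrite /refl_bracket -![_ * _]/(_ *m _) /= => ->.
by rewrite subrr mxE.
Qed.

End ReflectionModule.

(** * Standard tableaux *)

Section Tableaux.
Local Open Scope nat_scope.
Variable k : nat.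
Implicit Types (t u : tab k) (i j : 'I_k).

Definition box t i : 'I_k * 'I_k := val (tagged t) i.

Lemma box_std t : is_standard (tag t) (val (tagged t)).
Proof. exact: valP. Qed.

Lemma box_inj t : injective (box t).
Proof. by case/and4P: (box_std t) => /injectiveP. Qed.

Lemma box_codom t b : (b \in codom (box t)) = (b.2 < val (tag t) b.1).
Proof. by case/and4P: (box_std t) => _ /forallP/(_ b)/eqP. Qed.

Lemma box_row t i j :
  (box t i).1 = (box t j).1 -> (box t i).2 < (box t j).2 -> i < j.
Proof.
case/and4P: (box_std t) => _ _ /forallP/(_ i)/forallP/(_ j)/implyP h _ e l.
by apply: h; rewrite -/(box t i) -/(box t j) e eqxx.
Qed.

Lemma box_col t i j :
  (box t i).2 = (box t j).2 -> (box t i).1 < (box t j).1 -> i < j.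
Proof.
case/and4P: (box_std t) => _ _ _ /forallP/(_ i)/forallP/(_ j)/implyP h e l.
by apply: h; rewrite -/(box t i) -/(box t j) e eqxx.
Qed.

Lemma shape_mono (nu : partn k) i j : i <= j -> val nu j <= val nu i.
Proof.
by move=> ij; case/andP: (valP nu) => /forallP/(_ i)/forallP/(_ j)/implyP/(_ ij).
Qed.

(** Go first along row r to the column of i, then down that column; entries
    increase along both, and the corner box lies in the shape because the row
    lengths are nonincreasing. *)
Lemma box_corner t i (r c : 'I_k) : r <= (box t i).1 -> c <= (box t i).2 ->
  exists2 j, box t j = (r, c) & j <= i.
Proof.
case e : (box t i) => [r' c'] /= rr cc.
have c'nu : c' < val (tag t) r' by rewrite -(box_codom t (r', c')) -e codom_f.
have c'r : c' < val (tag t) r by apply: leq_trans c'nu (shape_mono _ rr).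
have /codomP[m em] : (r, c') \in codom (box t) by rewrite box_codom.
have /codomP[j ej] : (r, c) \in codom (box t).
  by rewrite box_codom /=; apply: leq_ltn_trans cc c'r.
exists j => //; apply: (@leq_trans m).
  have [cc'|cc'] := ltnP c c'; first by rewrite ltnW // (@box_row t) // -ej -em.
  have ecc : c = c' by apply/val_inj/eqP; rewrite eqn_leq cc.
  by rewrite (@box_inj t j m) // -ej -em ecc.
have [rr'|rr'] := ltnP r r'; first by rewrite ltnW // (@box_col t) // e -em.
have err : r = r' by apply/val_inj/eqP; rewrite eqn_leq rr.
by rewrite (@box_inj t m i) // e -em err.
Qed.

Lemma contentE t i : content t i = ((box t i).2%:Z - (box t i).1%:Z)%R.
Proof. by rewrite /content -/(box t i); case: (box t i). Qed.

Lemma eq_tab t u : box t =1 box u -> t = u.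
Proof.
move=> e; have etag : tag t = tag u.
  apply/val_inj/ffunP => r; apply: val_inj => /=.
  have h (c : 'I_k) : (c < val (tag t) r) = (c < val (tag u) r).
    by rewrite -(box_codom t (r, c)) -(box_codom u (r, c)) (eq_codom e).
  move: (val (tag t) r) (val (tag u) r) h => [a ha] [b hb] /= h.
  case: (ltngtP a b) => // ab.
    by have := h (Ordinal (leq_trans ab (hb : b <= k))); rewrite /= ab ltnn.
  by have := h (Ordinal (leq_trans ab (ha : a <= k))); rewrite /= ab ltnn.
case: t u etag e => [nu T] [nu' T'] /= enu; case: nu' / enu T' => T' e.
congr (Tagged _ _); apply/val_inj/ffunP => i; exact: e.
Qed.

(** By induction on the entries. If t and u agree before i but place i in different
    boxes of the same diagonal, the smaller of the two boxes is already filled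
    in the other tableau by an earlier entry, on which they agree. *)
Lemma content_inj t u : (forall i, content t i = content u i) -> t = u.
Proof.
move=> e; apply: eq_tab.
suff H m : forall i, i < m -> box t i = box u i by move=> i; apply: (H i.+1).
elim: m => [//|m IH] i; rewrite ltnS leq_eqVlt => /orP[/eqP im|]; last exact: IH.
have aux t' u' : (forall j, j < i -> box t' j = box u' j) -> content t' i = content u' i ->
    (box t' i).1 < (box u' i).1 -> False.
  move=> h; rewrite !contentE => ec l.
  have [|j ej ji] := @box_corner u' i (box t' i).1 (box t' i).2 (ltnW l); first by lia.
  have nji : j != i by apply/eqP => ji'; move: l; rewrite -ji' ej ji' ltnn.
  have lji : j < i by rewrite ltn_neqAle nji.
  have : box t' j = box t' i by rewrite h // ej; case: (box t' i).
  by move/box_inj => ji'; move: nji; rewrite ji' eqxx.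
have h j : j < i -> box t j = box u j by rewrite im; apply: IH.
have ei := e i; case: (ltngtP (box t i).1 (box u i).1) => l.
- by case: (aux t u).
- by case: (aux u t) => // j /h.
move: ei; rewrite !contentE l; case: (box t i) (box u i) l => [r c] [r' c'] /= /val_inj-> ec.
by congr pair; apply: val_inj => /=; lia.
Qed.

Definition tab_swap t u i j :=
  [/\ j = i.+1 :> nat, forall x, box u x = box t (tperm i j x) &
      ~~ ((`|content t i - content t j| <= 1)%R)].

(** If j = i+1 lies strictly south-east of i, the corner box between them would
    hold an entry strictly between i and i+1; if it lies north-west, it would
    precede i. In the two remaining quadrants the contents differ by at least 2. *)
Lemma tab_nonadjacent t i j : j = i.+1 :> nat ->
  (box t i).1 != (box t j).1 -> (box t i).2 != (box t j).2 ->
  ~~ ((`|content t i - content t j| <= 1)%R).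
Proof.
move=> ji nr nc; rewrite !contentE.
have nr' : (box t i).1 != (box t j).1 :> nat by [].
have nc' : (box t i).2 != (box t j).2 :> nat by [].
have [rr|rr] := ltnP (box t i).1 (box t j).1; have [cc|cc] := ltnP (box t i).2 (box t j).2.
- have [//|m em mj] := @box_corner t j (box t i).1 (box t j).2 (ltnW rr).
  have im : i < m by apply: (@box_row t); rewrite em.
  have jm : m = j by apply: val_inj => /=; lia.
  by move: nr; rewrite -jm em eqxx.
- lia.
- lia.
have [m em mi] := @box_corner t i (box t j).1 (box t j).2 rr cc.
have mj : m = j by apply: (@box_inj t); rewrite em; case: (box t j).
by move: mi; rewrite mj ji ltnn.
Qed.

Lemma tperm_lt i j (x y : 'I_k) : j = i.+1 :> nat -> x < y -> ~~ ((x == i) && (y == j)) ->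
  tperm i j x < tperm i j y.
Proof.
move=> ji xy; have neq (a b : 'I_k) : a <> b -> a <> b :> nat by move=> h /val_inj.
case: (tpermP i j x) => [xi|xj|/neq xi /neq xj];
  case: (tpermP i j y) => [yi|yj|/neq yi /neq yj]; rewrite ?xi ?xj ?yi ?yj ?eqxx //=;
  rewrite ?xi ?xj ?yi ?yj in xy *; lia.
Qed.

(** Exchanging i and i+1 only reverses the order of these two entries, so it can
    break standardness only within a common row or column. *)
Lemma tab_swap_exists t i j : j = i.+1 :> nat ->
  (box t i).1 != (box t j).1 -> (box t i).2 != (box t j).2 ->
  exists2 u, tag u = tag t & tab_swap t u i j.
Proof.
move=> ji nr nc; pose T : {ffun 'I_k -> 'I_k * 'I_k} := [ffun x => box t (tperm i j x)].
have TE x : T x = box t (tperm i j x) by rewrite ffunE.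
have std : is_standard (tag t) T.
  apply/and4P; split.
  - by apply/injectiveP => x y; rewrite !TE => /box_inj/perm_inj.
  - apply/forallP => b; rewrite -box_codom; apply/eqP; apply/idP/idP => /codomP[x ->].
      by rewrite TE codom_f.
    by rewrite -[x](tpermK i j) -TE codom_f.
  - apply/'forall_forallP => x y; apply/implyP => /andP[/eqP e l]; move: e l; rewrite !TE => e l.
    have := tperm_lt ji (box_row e l); rewrite !tpermK; apply.
    by apply/negP => /andP[/eqP xi /eqP yj]; move: nr; rewrite xi yj in e; rewrite e eqxx.
  apply/'forall_forallP => x y; apply/implyP => /andP[/eqP e l]; move: e l; rewrite !TE => e l.
  have := tperm_lt ji (box_col e l); rewrite !tpermK; apply.
  by apply/negP => /andP[/eqP xi /eqP yj]; move: nc; rewrite xi yj in e; rewrite e eqxx.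
exists (existT (fun nu : partn k => stdtab nu : Type) (tag t) (exist _ T std) : tab k) => //; split=> //.
exact: tab_nonadjacent.
Qed.

(** The increments of w are at least 1, and there is no room for more between
    its values at the two ends. *)
Lemma increasing_id (w : 'I_k -> 'I_k) :
  (forall i j, j = i.+1 :> nat -> w i < w j) -> w =1 id.
Proof.
move=> inc; have step d : forall i j, j = i + d :> nat -> w i + d <= w j.
  elim: d => [|d IH] i j; first by rewrite !addn0 => /val_inj->.
  move=> e; have lk : i + d < k by apply: leq_trans (ltn_ord j); rewrite e addnS.
  have := IH i (Ordinal lk) erefl; have := inc (Ordinal lk) j; rewrite e addnS => /(_ erefl).
  lia.
move=> i; apply: val_inj => /=; have ik := ltn_ord i.
have k0 : 0 < k by lia.
have k1 : k.-1 < k by lia.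
have := step i (Ordinal k0) i erefl; have := step (k.-1 - i) i (Ordinal k1).
have := ltn_ord (w (Ordinal k1)) => /=; lia.
Qed.

(** Let w(i) be the entry of u in the box of t that holds i. At a descent of w the
    entries i and i+1 of t can share neither a row nor a column, since u is
    standard, so they may be exchanged; this increases the sum of i w(i), which
    is bounded. Without descents w is the identity and t = u. *)
Theorem tab_connected (P : tab k -> tab k -> Prop) :
  (forall t, P t t) -> (forall t u v, P t u -> P u v -> P t v) ->
  (forall t u i j, tag u = tag t -> tab_swap t u i j -> P t u) ->
  forall t u, tag t = tag u -> P t u.
Proof.
move=> Prefl Ptrans Pswap t u.
have wex s : tag s = tag u -> exists w : {ffun 'I_k -> 'I_k}, forall i, box u (w i) = box s i.
  move=> e; have h i : box s i \in codom (box u) by rewrite box_codom -e -box_codom codom_f.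
  by exists [ffun i => iinv (h i)] => i; rewrite ffunE f_iinv.
suff H m : forall s, tag s = tag u -> forall w : {ffun 'I_k -> 'I_k},
    (forall i, box u (w i) = box s i) -> k * (k * k) - \sum_(i < k) i * w i < m -> P s u.
  by move=> e; have [w ew] := wex t e; apply: H ew (ltnSn _).
elim: m => [//|m IH] s es w ew wm.
have wI : injective w by move=> a b e; apply: (@box_inj s); rewrite -!ew e.
have [/existsP[i /existsP[j /andP[/eqP ji wji]]]|nodescent] :=
  boolP [exists i : 'I_k, exists j : 'I_k, (j == i.+1 :> nat) && (w j < w i)]; last first.
  suff -> : s = u by [].
  apply: eq_tab => i; rewrite -ew; congr (box u _); apply: (@increasing_id w) => a b ba.
  have := nodescent; rewrite negb_exists => /forallP/(_ a); rewrite negb_exists => /forallP/(_ b).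
  rewrite ba eqxx /= -leqNgt leq_eqVlt => /orP[/eqP/val_inj/wI ab|//].
  by have := ba; rewrite ab; lia.
have wij : w i != w j by rewrite -val_eqE /=; lia.
have nr : (box s i).1 != (box s j).1.
  apply/eqP => er; have nc : (box s i).2 != (box s j).2.
    apply/eqP => ec; have /box_inj ij : box s i = box s j.
      by move: er ec; case: (box s i) (box s j) => [? ?] [? ?] /= -> ->.
    by move: ji; rewrite ij; lia.
  have := ltngtP (box s i).2 (box s j).2; case=> [l|l|/val_inj l]; last by rewrite l eqxx in nc.
    have := @box_row u (w i) (w j); rewrite !ew => /(_ er l); lia.
  by have := box_row (esym er) l; lia.
have nc : (box s i).2 != (box s j).2.
  apply/eqP => ec.
  have := ltngtP (box s i).1 (box s j).1; case=> [l|l|/val_inj l]; last by rewrite l eqxx in nr.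
    have := @box_col u (w i) (w j); rewrite !ew => /(_ ec l); lia.
  by have := box_col (esym ec) l; lia.
have [v ev sw] := tab_swap_exists ji nr nc.
apply: (Ptrans _ v); first by apply: Pswap sw; rewrite ev.
pose w' : {ffun 'I_k -> 'I_k} := [ffun x => w (tperm i j x)].
apply: (IH v _ w'); first by rewrite ev.
  by move=> x; rewrite ffunE ew; case: sw => _ ->.
have nij : j != i by rewrite -val_eqE /= ji; lia.
have bound : \sum_(x < k) x * w' x <= k * (k * k).
  rewrite -[X in X * (k * k)]card_ord -sum_nat_const; apply: leq_sum => x _.
  by apply: leq_mul; apply: ltnW.
suff : \sum_(x < k) x * w x < \sum_(x < k) x * w' x by lia.
rewrite (bigD1 i) //= (bigD1 j) //= [X in _ < X](bigD1 i) //= [X in _ < _ + X](bigD1 j) //=.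
rewrite !ffunE tpermL tpermR.
rewrite [X in _ < _ + (_ + X)](eq_bigr (fun x : 'I_k => x * w x)); last first.
  by move=> x /andP[xi xj]; rewrite ffunE tpermD // eq_sym.
by rewrite !addnA ltn_add2r ji; nia.
Qed.
End Tableaux.

(** * Equivalence of Young idempotents of the same shape *)

Lemma expfz_inj (F : fieldType) (q : F) : q != 0 -> (forall m : nat, (0 < m)%N -> q ^+ m != 1) ->
  injective (fun z : int => q ^ z).
Proof.
move=> q0 qn1 x y; wlog xy : x y / x <= y => [h e|e].
  by case: (leP x y) => [xy|/ltW yx]; [|symmetry]; apply: h.
have : q ^ (y - x) = 1 by rewrite expfzDr // -e -expfzDr // subrr expr0z.
case E: (y - x) => [m|m]; last by lia.
case: m E => [|m] E; first by lia.
by move=> e1; have := qn1 m.+1 isT; rewrite -e1 eqxx.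
Qed.

Section YoungEquivalence.
Variables (F : fieldType) (q : F) (N k : nat) (s J : nat -> 'M[F]_N) (Y : tab k.+1 -> 'M[F]_N).
Hypotheses (q0 : q != 0) (qn1 : forall m : nat, (0 < m)%N -> q ^+ m != 1).
Hypothesis braid : forall i, (i.+1 < k)%N -> s i * s i.+1 * s i = s i.+1 * s i * s i.+1.
Hypothesis far : forall i j, (i.+1 < j < k)%N -> s i * s j = s j * s i.
Let lam := q - q^-1.
Hypothesis quad : forall i, (i < k)%N -> s i *m s i = 1%:M + lam *: s i.
Hypothesis J0 : J 0%N = 1.
Hypothesis JS : forall i, (i < k)%N -> J i.+1 = s i * J i * s i.
Hypothesis Yid : forall t, Y t *m Y t = Y t.
Hypothesis Ysum : \sum_t Y t = 1.
Let c (t : tab k.+1) i := q ^ (2 * content t i).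
Hypothesis JYl : forall t (i : 'I_k.+1), J i *m Y t = c t i *: Y t.
Hypothesis JYr : forall t (i : 'I_k.+1), Y t *m J i = c t i *: Y t.

(** Stands in for membership in the algebra generated by the s_i: it is all that
    is needed for an intertwiner to respect the action of the generators. *)
Definition bicommutant (X : 'M[F]_N) := forall C : 'M[F]_N,
  (forall i, (i < k)%N -> s i *m C = C *m s i) -> X *m C = C *m X.
Hypothesis Ybi : forall t, bicommutant (Y t).

Lemma bicommutant_mul X Z : bicommutant X -> bicommutant Z -> bicommutant (X *m Z).
Proof. by move=> bX bZ C sC; rewrite -mulmxA bZ // mulmxA bX // mulmxA. Qed.

Lemma eigenvalue_inj t u i j : c t i = c u j -> content t i = content u j.
Proof. by move/(expfz_inj q0 qn1); lia. Qed.

(** Each Y_v with v different from u kills W: some Jucys-Murphy element has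
    distinct eigenvalues on both, since contents determine the tableau and q is
    not a root of unity. The Y_v sum to 1. *)
Lemma eigen_Young u (W : 'M[F]_N) :
  (forall i : 'I_k.+1, J i *m W = c u i *: W) -> Y u *m W = W.
Proof.
move=> JW; rewrite -[RHS]mul1mx -[1%:M]Ysum mulmx_suml (bigD1 u) //= big1 ?addr0 // => v vu.
have [/existsP[i ci]|/existsPn ci] := boolP [exists i : 'I_k.+1, c v i != c u i]; last first.
  by case/eqP: vu; apply: content_inj => i; apply: eigenvalue_inj; apply/eqP; have := ci i; rewrite negbK.
have : (c v i - c u i) *: (Y v *m W) = 0.
  by rewrite scalerBl scalemxAl -JYr -mulmxA JW -scalemxAr subrr.
by move/eqP; rewrite scaler_eq0 subr_eq0 (negPf ci) => /eqP.
Qed.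

(** On a common eigenvector of J_i and J_(i+1) with eigenvalues a and b, this is
    the commutator s_i J_i - J_i s_i, the usual intertwining element of the
    Hecke algebra. *)
Definition swap_mx (a b : F) i : 'M[F]_N := (a - b) *: s i + (lam * b)%:M.

Lemma swap_mx_eigen a b i (e : 'M[F]_N) : (i < k)%N ->
  J i *m e = a *: e -> J i.+1 *m e = b *: e ->
  J i *m (swap_mx a b i *m e) = b *: (swap_mx a b i *m e) /\
  J i.+1 *m (swap_mx a b i *m e) = a *: (swap_mx a b i *m e).
Proof.
move=> ik Je Je'; have JE : J i.+1 = s i *m J i *m s i by exact: JS.
have Jse : J i *m (s i *m e) = b *: (s i *m e) + (- (lam * b)) *: e.
  have sJ : J i *m s i = (s i - lam%:M) *m J i.+1.
    rewrite JE !mulmxA mulmxBl quad // mul_scalar_mx addrK mul1mx //.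
  rewrite mulmxA sJ -mulmxA Je' -scalemxAr mulmxBl mul_scalar_mx.
  by rewrite scalerBr scalerA [b * _]mulrC scaleNr.
have J'se : J i.+1 *m (s i *m e) = a *: (s i *m e) + (lam * b) *: e.
  rewrite JE -!mulmxA (mulmxA (s i) (s i)) quad // mulmxDl mul1mx !mulmxDr Je.
  by rewrite -scalemxAl -!scalemxAr (mulmxA (s i) (J i)) (mulmxA (s i *m J i)) -JE Je' scalerA.
rewrite /swap_mx mulmxDl mul_scalar_mx -scalemxAl !mulmxDr -!scalemxAr Jse J'se Je Je'.
rewrite !scalerDr !scalerA -!addrA; split; congr (_ + _).
- by rewrite mulrC.
- by rewrite -scalerDl; congr (_ *: _); ring.
- by rewrite mulrC.
by rewrite -scalerDl; congr (_ *: _); ring.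
Qed.

Lemma swap_mxM a b i : (i < k)%N ->
  swap_mx b a i *m swap_mx a b i = (lam ^+ 2 * a * b - (a - b) ^+ 2)%:M.
Proof.
move=> ik; rewrite /swap_mx mulmxDl mul_scalar_mx -scalemxAl mulmxDr mul_mx_scalar -scalemxAr.
rewrite quad //; apply/matrixP => x y; rewrite !mxE; move: (s i x y) => m.
by case: (x == y); rewrite ?mulr1n ?mulr0n; ring.
Qed.

(** The scalar factors as -(a - q^2 b)(a - q^-2 b) with a = q^(2x), b = q^(2y). *)
Lemma swap_scalar_neq0 (x y : int) : ~~ (`|x - y| <= 1) ->
  lam ^+ 2 * q ^ (2 * x) * q ^ (2 * y) - (q ^ (2 * x) - q ^ (2 * y)) ^+ 2 != 0.
Proof.
move=> xy.
have -> : lam ^+ 2 * q ^ (2 * x) * q ^ (2 * y) - (q ^ (2 * x) - q ^ (2 * y)) ^+ 2 =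
   - (q ^ (2 * x) - q ^ (2 * (y + 1))) * (q ^ (2 * x) - q ^ (2 * (y - 1))).
  have -> : q ^ (2 * (y + 1)) = q ^ (2 * y) * q ^+ 2 by rewrite mulrDr expfzDr.
  have -> : q ^ (2 * (y - 1)) = q ^ (2 * y) * q ^- 2 by rewrite mulrBr expfzDr.
  rewrite /lam; move: (q ^ (2 * x)) (q ^ (2 * y)) => a b.
  by field.
rewrite mulf_neq0 // ?oppr_eq0 subr_eq0; apply/eqP => /(expfz_inj q0 qn1); lia.
Qed.

Definition Young_equiv t u := exists X Z : 'M[F]_N,
  [/\ bicommutant X /\ bicommutant Z, Y t *m X = X /\ X *m Y u = X,
      Y u *m Z = Z /\ Z *m Y t = Z, X *m Z = Y t & Z *m X = Y u].

Lemma bicommutant_swap a b i : (i < k)%N -> bicommutant (swap_mx a b i).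
Proof.
move=> ik C sC; rewrite mulmxDl mulmxDr scalar_mxC; congr (_ + _).
by rewrite -scalemxAl sC // scalemxAr.
Qed.

(** [swap_mx] exchanges the eigenvalues of J_i and J_(i+1) and commutes with the
    other Jucys-Murphy elements, so it maps Y_t into Y_u and back by
    [eigen_Young]; the two maps compose to a nonzero scalar. *)
Lemma Young_equiv_swap t u i j : tab_swap t u i j -> Young_equiv t u.
Proof.
case=> ji bu far_c; have ik : (i < k)%N by have := ltn_ord j; rewrite ji.
have cu x : c u x = c t (tperm i j x) by rewrite /c !contentE bu.
pose a := c t i; pose b := c t j.
have ci : c u i = b by rewrite cu tpermL.
have cj : c u j = a by rewrite cu tpermR.
have sJ (m : 'I_k.+1) : m != i -> m != j -> s i *m J m = J m *m s i.
  rewrite -!val_eqE /= ji => mi mj.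
  have c0 m' : (0 < m' < k)%N -> s m' * J 0%N = J 0%N * s m' by rewrite J0 mulr1 mul1r.
  have [l|l] := ltnP m i; first by apply: (ladder_comm_above far JS c0); rewrite l.
  apply: (ladder_comm_below braid far JS c0); have := ltn_ord m; lia.
have comm a' b' (m : 'I_k.+1) w : m != i -> m != j ->
    J m *m (swap_mx a' b' i *m Y w) = c w m *: (swap_mx a' b' i *m Y w).
  move=> mi mj; rewrite mulmxA /swap_mx mulmxDr -scalemxAr -sJ // scalar_mxC scalemxAl.
  by rewrite -mulmxDl -mulmxA JYl -scalemxAr.
have ct m : m != i -> m != j -> c u m = c t m.
  by move=> mi mj; rewrite cu tpermD // eq_sym.
have Jj w : J i.+1 *m Y w = c w j *: Y w by rewrite -ji JYl.
have YW : Y u *m (swap_mx a b i *m Y t) = swap_mx a b i *m Y t.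
  have [e1 e2] := swap_mx_eigen ik (JYl t i) (Jj t).
  apply: eigen_Young => m; case: (eqVneq m i) => [->|mi]; first by rewrite ci.
  case: (eqVneq m j) => [->|mj]; first by rewrite cj {1}ji.
  by rewrite comm // ct.
have YW' : Y t *m (swap_mx b a i *m Y u) = swap_mx b a i *m Y u.
  have [e1 e2] := swap_mx_eigen ik (JYl u i) (Jj u); rewrite ci cj in e1 e2.
  apply: eigen_Young => m; case: (eqVneq m i) => [->|mi] //.
  case: (eqVneq m j) => [->|mj]; first by rewrite {1}ji.
  by rewrite comm // ct.
pose kap := lam ^+ 2 * a * b - (a - b) ^+ 2.
have kap0 : kap != 0 by apply: swap_scalar_neq0.
have kapE : lam ^+ 2 * b * a - (b - a) ^+ 2 = kap by rewrite /kap; ring.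
exists (swap_mx b a i *m Y u), (kap^-1 *: (swap_mx a b i *m Y t)).
split.
- have bi a' b' := bicommutant_swap a' b' ik.
  split=> [|C sC]; first exact: bicommutant_mul.
  by rewrite -scalemxAl (bicommutant_mul (bi a b) (@Ybi t)) // scalemxAr.
- by rewrite YW' -mulmxA Yid.
- by rewrite -scalemxAr YW -scalemxAl -mulmxA Yid.
- rewrite -scalemxAr -mulmxA YW mulmxA swap_mxM // -/kap mul_scalar_mx scalerA mulVf //.
  by rewrite scale1r.
rewrite -scalemxAl -mulmxA YW' mulmxA swap_mxM // kapE mul_scalar_mx scalerA mulVf //.
by rewrite scale1r.
Qed.

Theorem Young_equiv_shape t u : tag t = tag u -> Young_equiv t u.
Proof.
apply: tab_connected.
- by move=> {}t; exists (Y t), (Y t); rewrite Yid.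
- move=> {u}t u v [X [Z [[bX bZ] [tX Xu] [uZ Zt] XZ ZX]]]
    [X' [Z' [[bX' bZ'] [uX' X'v] [vZ' Z'u] XZ' ZX']]].
  exists (X *m X'), (Z' *m Z); split.
  + by split; apply: bicommutant_mul.
  + by rewrite mulmxA tX -mulmxA X'v.
  + by rewrite mulmxA vZ' -mulmxA Zt.
  + by rewrite -mulmxA (mulmxA X') XZ' uZ.
  by rewrite -mulmxA (mulmxA Z) ZX uX'.
by move=> t' u' i j _; apply: Young_equiv_swap.
Qed.

End YoungEquivalence.

(** * The local representation of the Hecke algebra *)

Section HeckeImage.
Variables (F : fieldType) (n k : nat) (q : F) (R : tmx F n 2).
Hypotheses (q0 : q != 0) (YB : yang_baxter R) (heckeR : hecke_condition q R).
Local Notation N := #|widx n k.+1|.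
Let ev (x : hecke q k) : 'M[F]_N := hecke_eval R x.

Lemma hecke_rel_eval x : hecke_rel q x -> feval (fun i : 'I_k => Rat R k i) x = 0.
Proof.
move=> [i j ji|i j ij|i].
- apply: etrans (feval_braid _ _ _) _; rewrite ji; apply/eqP; rewrite subr_eq0; apply/eqP.
  by apply: Rat_braid => //; rewrite -ji.
- apply: etrans (feval_commutator _ _ _) _; apply/eqP; rewrite subr_eq0; apply/eqP.
  by case/orP: ij => ij; [|symmetry]; apply: Rat_far; rewrite ij /=.
apply: etrans (feval_quadratic _ _ _ _) _.
have RatD c : Rat R k i + c%:M = Rat (R + c%:M) k i.
  by rewrite -[c%:M in RHS]scalemx1 addrC [in RHS]addrC Rat_linear Rat1 scalemx1.
have RatB c : Rat R k i - c%:M = Rat (R - c%:M) k i.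
  by have := RatD (- c); rewrite !raddfN.
rewrite RatD RatB -Rat_mul // heckeR.
by rewrite -[0 in LHS](scale0r 1%:M) RatZ scale0r.
Qed.

Lemma hecke_eval_linear c x y : ev (c *: x + y) = c *: ev x + ev y.
Proof. exact: (qeval_linear hecke_rel_eval). Qed.

Lemma hecke_eval1 : ev 1 = 1.
Proof. exact: (qeval1 hecke_rel_eval). Qed.

Lemma hecke_evalM x y : ev (x * y) = ev x *m ev y.
Proof. exact: (qevalM hecke_rel_eval). Qed.

Lemma hecke_eval_sigma i : ev (sigma q i) = Rat R k i.
Proof.
rewrite -[RHS](feval_gen (fun i : 'I_k => Rat R k i)).
exact: (qeval_pi hecke_rel_eval).
Qed.

Lemma hecke_evalD x y : ev (x + y) = ev x + ev y.
Proof. by rewrite -[x]scale1r hecke_eval_linear !scale1r. Qed.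

Lemma hecke_eval0 : ev 0 = 0.
Proof. by apply: (@addrI _ (ev 0)); rewrite -hecke_evalD !addr0. Qed.

Lemma hecke_evalZ c x : ev (c *: x) = c *: ev x.
Proof. by rewrite -[c *: x]addr0 hecke_eval_linear hecke_eval0 addr0. Qed.

Lemma hecke_eval_comm (C : 'M[F]_N) x :
  (forall i, (i < k)%N -> Rat R k i *m C = C *m Rat R k i) -> ev x *m C = C *m ev x.
Proof. by move=> h; apply: feval_comm => i; apply: h. Qed.

Lemma enum_ord_ltnS i (ik : (i < k)%N) :
  [seq m : 'I_k <- enum 'I_k | (m < i.+1)%N] =
  rcons [seq m : 'I_k <- enum 'I_k | (m < i)%N] (Ordinal ik).
Proof.
have f j : (j <= k)%N ->
    map (@nat_of_ord k) [seq m : 'I_k <- enum 'I_k | (m < j)%N] = iota 0 j.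
  by move=> jk; rewrite -(filter_map _ (fun a => a < j)%N) val_enum_ord (filter_iota_ltn 0).
apply: (inj_map val_inj); rewrite map_rcons !f //; last exact: ltnW.
by rewrite -addn1 iotaD cats1.
Qed.

Lemma jucys_murphy0 : jucys_murphy q k 0 = 1.
Proof. by rewrite /jucys_murphy !big_pred0 ?mulr1. Qed.

Lemma jucys_murphyS i (ik : (i < k)%N) :
  jucys_murphy q k i.+1 = sigma q (Ordinal ik) * jucys_murphy q k i * sigma q (Ordinal ik).
Proof.
rewrite /jucys_murphy -!(big_filter (rev _)) !filter_rev -!(big_filter (enum _)) enum_ord_ltnS.
by rewrite rev_rcons big_cons big_rcons /= !mulrA.
Qed.

Lemma hecke_Young_equiv (Y : tab k.+1 -> hecke q k) t u :
  (forall m : nat, (0 < m)%N -> q ^+ m != 1) -> qYoung_family Y -> tag t = tag u ->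
  Young_equiv (Rat R k) (fun t => ev (Y t)) t u.
Proof.
move=> qn1 [Yprim Yorth Ysum JYl JYr].
apply: (Young_equiv_shape (q := q) (J := fun i => ev (jucys_murphy q k i))) => //.
- by move=> i ik; apply: Rat_braid.
- by move=> i j ij; apply: Rat_far.
- by move=> i ik; apply: (Rat_quad q0 heckeR).
- by rewrite jucys_murphy0 hecke_eval1.
- by move=> i ik; rewrite jucys_murphyS !hecke_evalM !hecke_eval_sigma.
- by move=> v; rewrite -hecke_evalM; case: (Yprim v) => _ ->.
- by rewrite -hecke_eval1 -Ysum; apply/esym/(big_morph ev hecke_evalD hecke_eval0).
- by move=> v i; rewrite -hecke_evalM JYl hecke_evalZ.
- by move=> v i; rewrite -hecke_evalM JYr hecke_evalZ.
by move=> v C sC; apply: hecke_eval_comm.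
Qed.
End HeckeImage.

Section Compression.
Variables (F : fieldType) (N : nat).
Implicit Types (C D : {vspace 'rV[F]_N}) (X E : 'M[F]_N).

(** Meaningful only when X maps C into D, as the projection onto D is arbitrary. *)
Definition compress C D X : 'Hom(subvs_of C, subvs_of D) :=
  (linfun (vsproj D) \o (mxact X \o linfun (@vsval _ _ C)))%VF.

Lemma mxactE X v : mxact X v = v *m X.
Proof. by rewrite lfunE. Qed.

Lemma val_compress C (D : {vspace 'rV[F]_N}) X (w : subvs_of C) :
  vsval w *m X \in D -> vsval (compress C D X w) = vsval w *m X.
Proof. by move=> h; rewrite !comp_lfunE !lfunE /= vsprojK ?mxactE. Qed.

Lemma mem_mximg E v : E *m E = E -> (v \in limg (mxact E)) = (v *m E == v).
Proof.
move=> EE; apply/memv_imgP/eqP => [[u _ ->]|vE]; first by rewrite mxactE -mulmxA EE.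
by exists v; rewrite ?memvf // mxactE vE.
Qed.
End Compression.

(** * The components as modules *)

Section RhoModule.
Variables (F : fieldType) (n k : nat) (q : F) (R Psi : tmx F n 2).
Hypotheses (q0 : q != 0) (YB : yang_baxter R) (heckeR : hecke_condition q R).
Hypothesis skew : skew_inverse R Psi.

Lemma rho_relations x : (exists I J, x = RE_relation R I J) -> feval (rho_gen k R Psi) x = 0.
Proof. by case=> I [J ->]; apply: rho_RE_relation q0 YB heckeR skew _ _. Qed.

Definition rho_mx (x : Lq R) : tmx F n k.+1 := (feval (rho_gen k R Psi) (qrepr x))^T.

Lemma rho_mx_linear c x y : rho_mx (c *: x + y) = c *: rho_mx x + rho_mx y.
Proof. by rewrite /rho_mx (qeval_linear rho_relations) linearP. Qed.

Lemma rho_mx1 : rho_mx 1 = 1%:M.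
Proof. by rewrite /rho_mx (qeval1 rho_relations) trmx1. Qed.

Lemma rho_mxM x y : rho_mx (x * y) = rho_mx y *m rho_mx x.
Proof. by rewrite /rho_mx (qevalM rho_relations) trmx_mul. Qed.

Lemma rho_mx_gen i j : rho_mx (lgen R i j) = rhot R Psi k i j.
Proof. by rewrite /rho_mx (qeval_pi rho_relations) feval_gen /rho_gen trmxK. Qed.

Lemma Rat_comm_rho m x : (m < k)%N -> Rat R k m *m rho_mx x = rho_mx x *m Rat R k m.
Proof.
move=> mk; apply: trmx_inj; rewrite !trmx_mul /rho_mx trmxK.
apply: feval_comm => -[i j]; rewrite /rho_gen -!trmx_mul.
by rewrite (rhot_comm Psi q0 YB heckeR).
Qed.
End RhoModule.

Section Components.
Variables (F : fieldType) (n k : nat) (q : F) (R Psi : tmx F n 2) (Y : tab k.+1 -> hecke q k).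
Hypotheses (q0 : q != 0) (qn1 : forall m : nat, (0 < m)%N -> q ^+ m != 1).
Hypotheses (YB : yang_baxter R) (heckeR : hecke_condition q R) (skew : skew_inverse R Psi).
Hypothesis YY : qYoung_family Y.

Let E t := hecke_eval R (Y t).
Let M := @rho_mx F n k R Psi.

Lemma Young_mx_idem t : E t *m E t = E t.
Proof.
rewrite -(hecke_evalM YB heckeR).
by have [_ ->] := qY_primitive YY t.
Qed.

Lemma Young_mx_orth t u : t != u -> E t *m E u = 0.
Proof.
move=> tu; rewrite -(hecke_evalM YB heckeR) (qY_orthogonal YY) //.
exact: (hecke_eval0 _ YB heckeR).
Qed.

Lemma hecke_eval_comm_rho x y : hecke_eval R x *m M y = M y *m hecke_eval R (x : hecke q k).
Proof. by apply: hecke_eval_comm => i ik; apply: (Rat_comm_rho Psi q0 YB heckeR). Qed.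

Lemma mem_component t v : (v \in component R Y t) = (v *m E t == v).
Proof. exact/mem_mximg/Young_mx_idem. Qed.

Lemma component_stable t x v : v \in component R Y t -> v *m M x \in component R Y t.
Proof.
by rewrite !mem_component => /eqP e; rewrite -mulmxA -hecke_eval_comm_rho mulmxA e.
Qed.

Definition component_action t (x : Lq R) : 'End(subvs_of (component R Y t)) :=
  compress (component R Y t) (component R Y t) (M x).

Lemma val_component_action t x w : vsval (component_action t x w) = vsval w *m M x.
Proof. by rewrite val_compress // component_stable // subvsP. Qed.

Lemma component_module t : Lq_module (component_action t).
Proof.
split=> [c x y| |x y]; apply/lfunP => w; apply: val_inj.
- rewrite [LHS]val_component_action /M (rho_mx_linear k q0 YB heckeR skew) mulmxDr -scalemxAr.
  by rewrite add_lfunE scale_lfunE [RHS]linearD [in RHS]linearZ /= !val_component_action.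
- by rewrite [LHS]val_component_action /M (rho_mx1 k q0 YB heckeR skew) mulmx1 id_lfunE.
rewrite comp_lfunE [LHS]val_component_action [RHS]val_component_action val_component_action.
by rewrite /M (rho_mxM k q0 YB heckeR skew) mulmxA.
Qed.

(** As the action commutes with the idempotent, compressing it on both sides only
    applies the idempotent once more, which is the identity on the component. *)
Lemma component_zero_extension t i j :
  zero_extension (component_action t (lgen R i j)) (mxact (E t *m rhot R Psi k i j *m E t)).
Proof.
rewrite -(rho_mx_gen k q0 YB heckeR skew) -/(M _); split=> [w|u ut v].
  have /eqP e : vsval w *m E t == vsval w by rewrite -mem_component subvsP.
  rewrite mxactE val_component_action -(mulmxA (E t)) -hecke_eval_comm_rho -/(E t).
  by rewrite (mulmxA (E t)) Young_mx_idem mulmxA e.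
rewrite mem_component mxactE => /eqP <-.
by rewrite !mulmxA -(mulmxA v) Young_mx_orth ?mulmx0 ?mul0mx.
Qed.

(** Matrices act on row vectors, so the image of Y_t is mapped to that of Y_u by
    right multiplication with X = Y_t X Y_u. *)
Lemma component_equiv t u : tag t = tag u ->
  Lq_equiv (component_action t) (component_action u).
Proof.
move=> tu; have := hecke_Young_equiv q0 YB heckeR qn1 YY tu.
case=> [X [Z [[bX bZ] [tX Xu] [uZ Zt] XZ ZX]]].
have memX v : v \in component R Y t -> v *m X \in component R Y u.
  by rewrite !mem_component -mulmxA Xu.
have memZ v : v \in component R Y u -> v *m Z \in component R Y t.
  by rewrite !mem_component -mulmxA Zt.
pose f := compress (component R Y t) (component R Y u) X.
pose g := compress (component R Y u) (component R Y t) Z.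
have fE w : vsval (f w) = vsval w *m X by rewrite val_compress // memX // subvsP.
have gE w : vsval (g w) = vsval w *m Z by rewrite val_compress // memZ // subvsP.
exists f.
  exists g => w; apply: val_inj; rewrite [LHS]/= [LHS](gE, fE) ?(gE, fE) -mulmxA.
    by rewrite XZ; apply/eqP; rewrite -mem_component subvsP.
  by rewrite ZX; apply/eqP; rewrite -mem_component subvsP.
move=> x; apply/lfunP => w; apply: val_inj.
have -> : (f \o component_action t x)%VF w = f (component_action t x w) by rewrite comp_lfunE.
have -> : (component_action u x \o f)%VF w = component_action u x (f w) by rewrite comp_lfunE.
rewrite [LHS]fE [RHS]val_component_action fE val_component_action -!mulmxA; congr (_ *m _).
by apply/esym/bX => i ik; apply: (Rat_comm_rho Psi q0 YB heckeR).
Qed.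
End Components.

Theorem proposition3 (K : realType) (n p k : nat) (q : K[i])
    (R Psi : tmx K[i] n 2) (Y : tab k.+1 -> hecke q k) :
  (0 < n)%N ->
  q != 0 ->
  (forall m : nat, (0 < m)%N -> q ^+ m != 1) ->
  yang_baxter R ->
  hecke_condition q R ->
  skew_inverse R Psi ->
  symmetry_rank q R p ->
  qYoung_family Y ->
  exists pi : forall t : tab k.+1, Lq R -> 'End(subvs_of (component R Y t)),
    (forall t : tab k.+1,
       Lq_module (pi t) /\
       (forall i j : 'I_n,
          zero_extension (pi t (lgen R i j))
            (mxact (hecke_eval R (Y t) *m rhot R Psi k i j *m
                    hecke_eval R (Y t))))) /\
    (forall t u : tab k.+1, tag t = tag u -> Lq_equiv (pi t) (pi u)).
Proof.
move=> _ q0 qn1 YB heckeR skew _ YY.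
exists (component_action Psi Y); split=> [t|t u]; last exact: component_equiv.
split; first exact: component_module.
by move=> i j; apply: component_zero_extension.
Qed.
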